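(* The domains $\mathbb{H}$ and $\mathbb{F}$ in $\mathbb{C}^4$ are not biholomorphic to each other, i.e., there is no biholomorphic map from $\mathbb{F}$ onto $\mathbb{H}$.
   Context: $\mathbb{D}=\{z\in\mathbb{C}:|z|<1\}$; $M_2(\mathbb{C})$ is the space of $2\times 2$ complex matrices and $\|A\|$ is the operator norm of $A$. The domain $\mathbb{F}$ is \[ \mathbb{F}=\{(a_{11},a_{22},\det(A),a_{12}+a_{21})\in\mathbb{C}^4 : A=(a_{ij})_{i,j=1}^2\in M_2(\mathbb{C}),\ \|A\|<1\}. \] The tetrablock is $\mathbb{E}=\{(x_1,x_2,x_3)\in\mathbb{C}^3 : 1-x_1z_1-x_2z_2+x_3z_1z_2\neq 0 \text{ for all } |z_1|\le 1,\ |z_2|\le 1\}$. The hexablock is \[ \mathbb{H}=\left\{(a,x_1,x_2,x_3)\in\mathbb{C}\times\mathbb{E} : \sup_{z_1,z_2\in\mathbb{D}}\left|\frac{a\sqrt{(1-|z_1|^2)(1-|z_2|^2)}}{1-x_1z_1-x_2z_2+x_3z_1z_2}\right|<1\right\}. \] *)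

(* Defs.v *)
From mathcomp Require Import all_boot all_order all_algebra complex.
From mathcomp Require Import all_classical all_reals all_analysis.

Set Implicit Arguments.
Unset Strict Implicit.
Unset Printing Implicit Defensive.

Import Order.TTheory GRing.Theory Num.Theory.
Import numFieldNormedType.Exports.

Local Open Scope classical_set_scope.
Local Open Scope complex_scope.
Local Open Scope ring_scope.

Section Holomorphy.
Variable R : realType.
Implicit Types V W : normedModType R[i].

(* [differentiable] is Frechet differentiability over the field of scalars,
   here R[i], so this is complex differentiability at each point of D.  It is
   the usual notion of holomorphy when D is open. *)
Definition holomorphic_on V W (D : set V) (f : V -> W) : Prop :=
  forall x : V, D x -> differentiable f x.

Definition biholomorphic_map V W (D : set V) (E : set W) (f : V -> W) : Prop :=
  [/\ set_bij D E f,
      holomorphic_on D f &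
      exists2 g : W -> V,
        holomorphic_on E g & forall x : V, D x -> g (f x) = x].

Definition biholomorphic V W (D : set V) (E : set W) : Prop :=
  exists f : V -> W, biholomorphic_map D E f.

End Holomorphy.

Section Domains.
Variable R : realType.
Local Notation C := R[i].

(* The library norm `|z| of z : R[i] lives in R[i]; this is its value in R. *)
Definition cmod (z : C) : R := complex.Re `|z|.

Definition unit_disc : set C := [set z | cmod z < 1].

(* The library norm on matrices is the maximum norm. *)
Definition l2norm (n : nat) (v : 'cV[C]_n) : R :=
  Num.sqrt (\sum_(i < n) cmod (v i 0) ^+ 2).

Definition opnorm (m n : nat) (A : 'M[C]_(m, n)) : \bar R :=
  ereal_sup [set (l2norm (A *m v))%:E | v in [set v | l2norm v <= 1]].

Definition domainF : set 'rV[C]_4 :=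
  [set \row_(i < 4) [:: A 0 0; A 1 1; \det A; A 0 1 + A 1 0]`_i
     | A in [set A : 'M[C]_2 | (opnorm A < 1)%E]].

Definition tetra_denom (x : 'rV[C]_3) (z1 z2 : C) : C :=
  1 - x 0 0 * z1 - x 0 1 * z2 + x 0 2 * z1 * z2.

Definition tetrablock : set 'rV[C]_3 :=
  [set x | forall z1 z2 : C, cmod z1 <= 1 -> cmod z2 <= 1 ->
     tetra_denom x z1 z2 != 0].

Definition hexa_quotient (a : C) (x : 'rV[C]_3) (z1 z2 : C) : C :=
  a * (Num.sqrt ((1 - cmod z1 ^+ 2) * (1 - cmod z2 ^+ 2)))%:C
    / tetra_denom x z1 z2.

(* row_mx a%:M x is the vector (a, x_1, x_2, x_3). *)
Definition hexablock : set 'rV[C]_4 :=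
  [set v | exists (a : C) (x : 'rV[C]_3),
     [/\ v = row_mx a%:M x,
         tetrablock x &
         (ereal_sup [set (cmod (hexa_quotient a x z1 z2))%:E
            | z1 in unit_disc & z2 in unit_disc] < 1)%E]].

End Domains.

(* Main.v *)
Require Import Defs.
From HB Require Import structures.
From mathcomp Require Import all_boot all_order all_algebra complex.
From mathcomp Require Import all_classical all_reals all_analysis.
From mathcomp Require Import ring lra.

(** Let T(D, p) be the set of all derivatives phi'(0) of analytic discs
phi : unit disc -> D with phi(0) = p.  The differential at p of a biholomorphic
map f from D onto E maps T(D, p) onto T(E, f p), so that every automorphism
of D that fixes p becomes a linear symmetry of T(E, f p).  The two domains are
told apart by comparing the symmetries of the hexablock at its origin with the
symmetries of F at an arbitrary point.

The hexablock H at 0.  Rotating a, x_1 and x_2, with x_3 turned accordingly, is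
an automorphism of H, and rotating the parameter of a disc supplies one more
circle: T(H, 0) is invariant under all diagonal unitary matrices.  It contains
(1,0,0,1) and (0,1,1,0), and the Schwarz lemma gives, for j = 1, 2,
  |v_0|^2 + |v_j|^2 <= 1   and   |v_j| + |v_3| <= 1   on T(H, 0)
([hexa_test_body]).  If G is a linear involution that preserves T(H, 0), then G
composed with diagonal unitary matrices gives complex reflections of arbitrary
angle that preserve T(H, 0), and this leaves no room: G maps every coordinate
axis to a coordinate axis ([involutive_symmetry_monomial]).

The domain F.  The unit ball of the 2 x 2 matrices is the Lie ball in C^4, on
which F is obtained by dividing by z_4 -> - z_4: in the coordinates z_1, z_2,
z_3 and q = z_1^2 + ... + z_4^2, the determinant, F is given by |q| < 1 and
  |z|^2 + |q - z.z| < (1 + |q|^2) / 2   ([domainF_lie_to_F]).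
In homogeneous coordinates [z : 1 : q] this only involves the quadratic form
z.z - q and its Hermitian counterpart on the complexification of R^(3,2);
hence the reflections of R^(3,2) act on F by projective transformations
([reflection_in_lie_quotient]).  Those real vectors which are orthogonal to a
given point p of F form a real space of dimension 3, on which the form is
positive ([fixing_eta_lt]).  They yield reflections that fix p, and the
differentials at p of the latter are the involutions
  x |-> x - b(x) w,
where w runs through the nonzero real combinations of three vectors of C^4
which are linearly independent over C ([refl_dirs_inj]).

Conclusion.  Take p with f(p) = 0.  The differential of f turns these
involutions into monomial ones, which forces the image of w to have at most
two nonzero coordinates.  But a generic real combination of three independent
vectors of C^4 has at least three ([real_combinations_not_sparse]).

Holomorphy is only assumed in the form of complex differentiability at each
point, so the Schwarz lemma is obtained from Goursat's bisection argument.  It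
is applied to Re (f(z)/z) and Im (f(z)/z) in the coordinates log |z|, arg z, in
which an annulus becomes a rectangle and the two radial sides cancel: the mean
of Re (f(z)/z) over a circle does not depend on its radius
([mean_value_le]). *)

Set Implicit Arguments.
Unset Strict Implicit.
Unset Printing Implicit Defensive.
Import Order.TTheory GRing.Theory Num.Theory.
Import numFieldNormedType.Exports.
Local Open Scope classical_set_scope.
Local Open Scope complex_scope.
Local Open Scope ring_scope.

(** * Goursat theorem for real differential forms on rectangles *)

Section RealGoursat.
Variable R : realType.
Implicit Types (u U : R -> R) (P Q : R -> R -> R).

Lemma continuous_has_primitive u (a c : R) :
    (forall x, x < c -> {for x, continuous u}) ->
  exists U, forall x, a < x < c -> is_derive x 1 U (u x).
Proof.
move=> cu.
exists (fun x => \int[lebesgue_measure]_(t in [set` `[a, x]]) u t) => x /andP[ax xc].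
have [xm mc] := midf_lt xc.
have [|d e] := @continuous_FTC1_closed R u a x _ xm _ ax (cu x xc).
  apply: continuous_compact_integrable; first exact: segment_compact.
  apply: continuous_in_subspaceT => y; rewrite inE/= in_itv/= => /andP[_ ym].
  by apply: cu; exact: le_lt_trans mc.
by rewrite derive1E in e; exact: DeriveDef d e.
Qed.

Lemma increment_le U u (a b e : R) : a <= b ->
    (forall x, a <= x <= b -> is_derive x 1 U (u x)) ->
    (forall x, a <= x <= b -> `|u x| <= e) ->
  `|U b - U a| <= e * (b - a).
Proof.
move=> ab dU ue.
have [||c cab ->] := @MVT_segment R U u a b ab.
- move=> x; rewrite in_itv/= => /andP[ax xb].
  by apply: dU; rewrite !ltW.
- apply: derivable_within_continuous => x; rewrite in_itv/= => xab.
  by have [] := dU _ xab.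
- rewrite normrM (ger0_norm (_ : 0 <= b - a)) ?subr_ge0//.
  by rewrite ler_wpM2r ?subr_ge0// ue//; move: cab; rewrite in_itv.
Qed.

(** Integration of an affine approximation of [u]; the primitive [U] stands for
the integral of [u], so that no integral appears in the bisection below. *)
Lemma increment_affine U u (a b c al be e : R) : a <= b ->
    (forall x, a <= x <= b -> is_derive x 1 U (u x)) ->
    (forall x, a <= x <= b -> `|u x - (al + be * (x - c))| <= e) ->
  `|U b - U a - (al * (b - a) + be / 2 * ((b - c) ^+ 2 - (a - c) ^+ 2))|
    <= e * (b - a).
Proof.
move=> ab dU ue.
pose V x := U x - (al * (x - c) + be / 2 * (x - c) ^+ 2).
have -> : U b - U a - (al * (b - a) + be / 2 * ((b - c) ^+ 2 - (a - c) ^+ 2))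
  = V b - V a by rewrite /V; ring.
apply: (@increment_le _ (fun x => u x - (al + be * (x - c)))) => // x xab.
have := dU _ xab => dUx.
rewrite /V.
apply: is_derive_eq.
by rewrite /GRing.scale/= ; field.
Qed.

(** Repeatedly cutting a rectangle into four leads to a point common to all the
rectangles that are kept: their lower left corners increase towards it. *)
Lemma bisection_point (x0 y0 dx dy : R) (D : nat -> R -> R -> Prop) :
    0 <= dx -> 0 <= dy -> D 0%N x0 y0 ->
    (forall n x y, D n x y ->
       exists i j : bool, D n.+1 (x + i%:R * (dx / 2 ^+ n.+1))
                                 (y + j%:R * (dy / 2 ^+ n.+1))) ->
  exists a b, forall n, exists x y, [/\ D n x y,
    x <= a <= x + dx / 2 ^+ n, y <= b <= y + dy / 2 ^+ n,
    x0 <= x /\ x + dx / 2 ^+ n <= x0 + dx &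
    y0 <= y /\ y + dy / 2 ^+ n <= y0 + dy].
Proof.
move=> dx0 dy0 D0 Dstep.
have /choice[nxt nxtP] : forall t : nat * R * R, exists q : R * R,
    D t.1.1 t.1.2 t.2 ->
    [/\ D t.1.1.+1 q.1 q.2,
      t.1.2 <= q.1 /\ q.1 + dx / 2 ^+ t.1.1.+1 <= t.1.2 + dx / 2 ^+ t.1.1 &
      t.2 <= q.2 /\ q.2 + dy / 2 ^+ t.1.1.+1 <= t.2 + dy / 2 ^+ t.1.1].
  move=> [[n x] y] /=.
  have [Dn|] := pselect (D n x y); last by exists (0, 0).
  have [i [j Dij]] := Dstep _ _ _ Dn.
  exists (x + i%:R * (dx / 2 ^+ n.+1), y + j%:R * (dy / 2 ^+ n.+1)) => _ /=.
  have half (d : R) : d / 2 ^+ n = d / 2 ^+ n.+1 + d / 2 ^+ n.+1.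
    by rewrite exprS invfM; field; rewrite expf_neq0.
  have h0 (d : R) : 0 <= d -> 0 <= d / 2 ^+ n.+1 by move=> ?; rewrite divr_ge0.
  have := h0 _ dx0; have := h0 _ dy0.
  split=> //; rewrite half; move: (dx / _) (dy / _) H H0 {Dij} => p q hp hq.
    by case: i; rewrite ?mul0r ?mul1r; split; lra.
  by case: j; rewrite ?mul0r ?mul1r; split; lra.
pose s := fix s n : R * R := if n is m.+1 then nxt (m, (s m).1, (s m).2) else (x0, y0).
have sD n : D n (s n).1 (s n).2.
  by elim: n => // n IH; have [] := nxtP (n, (s n).1, (s n).2) IH.
have s1 n : (s n).1 <= (s n.+1).1 /\
    (s n.+1).1 + dx / 2 ^+ n.+1 <= (s n).1 + dx / 2 ^+ n.
  by have [] := nxtP (n, (s n).1, (s n).2) (sD n).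
have s2 n : (s n).2 <= (s n.+1).2 /\
    (s n.+1).2 + dy / 2 ^+ n.+1 <= (s n).2 + dy / 2 ^+ n.
  by have [] := nxtP (n, (s n).1, (s n).2) (sD n).
have nested (t : nat -> R) (d : R) : 0 <= d ->
    (forall n, t n <= t n.+1 /\ t n.+1 + d / 2 ^+ n.+1 <= t n + d / 2 ^+ n) ->
    exists a, forall n, [/\ t n <= a <= t n + d / 2 ^+ n, t 0%N <= t n &
      t n + d / 2 ^+ n <= t 0%N + d].
  move=> d0 tn.
  have up : {homo t : m n / (m <= n)%N >-> m <= n}.
    by apply: homo_leq => // [? ? ?|n]; [exact: le_trans|case: (tn n)].
  have dn n m : (n <= m)%N -> t m + d / 2 ^+ m <= t n + d / 2 ^+ n.
    move=> nm; rewrite -(subnK nm); elim: (m - n)%N => // k IH.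
    by rewrite addSn; apply: le_trans IH; case: (tn (k + n)%N).
  have bnd n m : t m <= t n + d / 2 ^+ n.
    have d'0 k : 0 <= d / 2 ^+ k by rewrite divr_ge0.
    apply: (@le_trans _ _ (t (maxn n m))); first by rewrite up// leq_maxr.
    by apply: le_trans (dn _ _ (leq_maxl n m)); rewrite lerDl.
  have hs : has_sup (range t).
    split; first by exists (t 0%N), 0%N.
    by exists (t 0%N + d / 2 ^+ 0) => _ [m _ <-].
  exists (sup (range t)) => n; split.
  - apply/andP; split; first by apply: ub_le_sup; [case: hs|exists n].
    by apply: ge_sup; [case: hs|move=> _ [m _ <-]].
  - exact: up.
  - by have := dn 0%N n isT; rewrite expr0 divr1.
have [a aP] := nested (fun n => (s n).1) dx dx0 s1.
have [b bP] := nested (fun n => (s n).2) dy dy0 s2.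
exists a, b => n; exists (s n).1, (s n).2.
by have [? ? ?] := aP n; have [? ? ?] := bP n.
Qed.

(** The integral of the form P dx + Q dy along a rectangle vanishes for the affine
part of (P, Q), because the y-slope of P and the x-slope of Q are the same
number [p2]; only the error of approximation is left. *)
Lemma small_rectangle_le P Q (PP QQ : R -> R -> R) (x y h k a b : R)
    (p1 p2 q2 e : R) :
    0 <= h -> 0 <= k ->
    (forall x' y', x <= x' <= x + h -> y <= y' <= y + k ->
       is_derive x' 1 (PP^~ y') (P x' y') /\ is_derive y' 1 (QQ x') (Q x' y')) ->
    (forall x' y', x <= x' <= x + h -> y <= y' <= y + k ->
       `|P x' y' - P a b - p1 * (x' - a) - p2 * (y' - b)| <= e /\
       `|Q x' y' - Q a b - p2 * (x' - a) - q2 * (y' - b)| <= e) ->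
  `|(QQ (x + h) (y + k) - QQ (x + h) y - (QQ x (y + k) - QQ x y))
    - (PP (x + h) (y + k) - PP x (y + k) - (PP (x + h) y - PP x y))|
  <= 2 * (e * (h + k)).
Proof.
move=> h0 k0 dPQ loc.
have Qi x' : x <= x' <= x + h ->
  `|QQ x' (y + k) - QQ x' y - ((Q a b + p2 * (x' - a)) * (y + k - y)
     + q2 / 2 * ((y + k - b) ^+ 2 - (y - b) ^+ 2))| <= e * (y + k - y).
  move=> x'P; apply: (@increment_affine (QQ x') (Q x')); first by rewrite lerDl.
  - by move=> y' y'P; case: (dPQ x' y').
  - move=> y' y'P; have [_] := loc x' y' x'P y'P.
    by rewrite [X in `|X| <= _ -> _](_ : _ = Q x' y' - (Q a b + p2 * (x' - a) + q2 * (y' - b)))//; ring.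
have Pi y' : y <= y' <= y + k ->
  `|PP (x + h) y' - PP x y' - ((P a b + p2 * (y' - b)) * (x + h - x)
     + p1 / 2 * ((x + h - a) ^+ 2 - (x - a) ^+ 2))| <= e * (x + h - x).
  move=> y'P; apply: (@increment_affine (PP^~ y') (P^~ y')); first by rewrite lerDl.
  - by move=> x' x'P; case: (dPQ x' y').
  - move=> x' x'P; have [+ _] := loc x' y' x'P y'P.
    by rewrite [X in `|X| <= _ -> _](_ : _ = P x' y' - (P a b + p2 * (y' - b) + p1 * (x' - a))) //; ring.
have := Qi (x + h); have := Qi x; have := Pi (y + k); have := Pi y.
rewrite !lexx/= !lerDl h0 k0 => /(_ isT) A /(_ isT) B /(_ isT) C /(_ isT) E.
clear -A B C E; move: A B C E.
rewrite !ler_norml => /andP[? ?] /andP[? ?] /andP[? ?] /andP[? ?].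
by apply/andP; split; lra.
Qed.

(** Goursat's theorem for P dx + Q dy, with the closedness of the form required
at each point but without any continuity of the partial derivatives.  The sides
of the rectangle are integrated by means of the primitives [PP] and [QQ].
If the integral were nonzero, bisection would produce rectangles shrinking to a
point along which the integral decreases only as fast as the area, against
[small_rectangle_le]. *)
Lemma goursat_rectangle P Q (PP QQ : R -> R -> R) (x0 y0 dx dy : R) :
    0 < dx -> 0 < dy ->
    (forall x y, x0 <= x <= x0 + dx -> y0 <= y <= y0 + dy ->
       is_derive x 1 (PP^~ y) (P x y) /\ is_derive y 1 (QQ x) (Q x y)) ->
    (forall a b, x0 <= a <= x0 + dx -> y0 <= b <= y0 + dy ->
       exists p1 p2 q2, forall e, 0 < e -> exists2 d, 0 < d &
       forall x y, x0 <= x <= x0 + dx -> y0 <= y <= y0 + dy ->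
         `|x - a| < d -> `|y - b| < d ->
         `|P x y - P a b - p1 * (x - a) - p2 * (y - b)|
            <= e * (`|x - a| + `|y - b|) /\
         `|Q x y - Q a b - p2 * (x - a) - q2 * (y - b)|
            <= e * (`|x - a| + `|y - b|)) ->
  (QQ (x0 + dx) (y0 + dy) - QQ (x0 + dx) y0)
    - (QQ x0 (y0 + dy) - QQ x0 y0)
  = (PP (x0 + dx) (y0 + dy) - PP x0 (y0 + dy))
    - (PP (x0 + dx) y0 - PP x0 y0).
Proof.
move=> dx0 dy0 dPQ locl.
pose K x y := QQ x y - PP x y.
pose M x y s t := K (x + s) (y + t) - K (x + s) y - K x (y + t) + K x y.
suff : M x0 y0 dx dy = 0 by rewrite /M /K; lra.
apply/eqP; apply: contraT => M0.
have eta0 : 0 < `|M x0 y0 dx dy| by rewrite normr_gt0.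
set eta := `|_| in eta0.
(* the property that is passed on to one of the four quarters *)
pose D n x y := eta / 4 ^+ n <= `|M x y (dx / 2 ^+ n) (dy / 2 ^+ n)|.
have [| | |n x y Dn|a [b abP]] := @bisection_point x0 y0 dx dy D.
- exact: ltW.
- exact: ltW.
- by rewrite /D !expr0 !divr1.
- set h := dx / 2 ^+ n.+1; set k := dy / 2 ^+ n.+1.
  have hE : dx / 2 ^+ n = h + h.
    by rewrite /h exprS invfM; field; rewrite expf_neq0.
  have kE : dy / 2 ^+ n = k + k.
    by rewrite /k exprS invfM; field; rewrite expf_neq0.
  have eE : eta / 4 ^+ n = 4 * (eta / 4 ^+ n.+1).
    by rewrite exprS invfM; field; rewrite expf_neq0.
  move: Dn; rewrite /D hE kE eE.
  have -> : M x y (h + h) (k + k) = M x y h k + M (x + h) y h k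
      + M x (y + k) h k + M (x + h) (y + k) h k.
    by rewrite /M (addrA x) (addrA y); clearbody K; ring.
  rewrite -/h -/k; set e' := eta / _ => He.
  have [h1|h1] := leP e' `|M x y h k|.
    by exists false, false; rewrite !mul0r !addr0.
  have [h2|h2] := leP e' `|M (x + h) y h k|.
    by exists true, false; rewrite !mul0r mul1r !addr0.
  have [h3|h3] := leP e' `|M x (y + k) h k|.
    by exists false, true; rewrite !mul0r mul1r !addr0.
  have [h4|h4] := leP e' `|M (x + h) (y + k) h k|.
    by exists true, true; rewrite !mul1r.
  have : `|M x y h k + M (x + h) y h k
      + M x (y + k) h k + M (x + h) (y + k) h k| < 4 * e'.
    apply: le_lt_trans (ler_normD _ _) _.
    have := ler_normD (M x y h k + M (x + h) y h k) (M x (y + k) h k).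
    have := ler_normD (M x y h k) (M (x + h) y h k); lra.
  by rewrite ltNge He.
have [x [y [_ /andP[xa ax] /andP[yb yb2] [x0x xx0] [y0y yy0]]]] := abP 0%N.
have a_in : x0 <= a <= x0 + dx by rewrite (le_trans x0x xa) (le_trans ax).
have b_in : y0 <= b <= y0 + dy by rewrite (le_trans y0y yb) (le_trans yb2).
have [p1 [p2 [q2 /(_ (eta / (3 * (dx + dy) ^+ 2)))]]] := locl a b a_in b_in.
have dd0 : 0 < (dx + dy) ^+ 2 by rewrite exprn_gt0// addr_gt0.
case=> [|d d0 dP]; first by rewrite divr_gt0// mulr_gt0.
(* rectangles of the n-th generation are so small that the estimate at (a, b) applies *)
have [n nd] : exists n, (dx + dy) / 2 ^+ n < d.
  have : (fun n => (dx + dy) / 2 ^+ n) @ \oo --> (0 : R).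
    rewrite -[X in _ --> X](mulr0 (dx + dy)); apply: cvgMr.
    rewrite (_ : (fun n => (2 ^+ n)^-1) = (fun n => (2^-1 : R) ^+ n)); last first.
      by apply/funext => n; rewrite exprVn.
    by apply: cvg_expr; rewrite ger0_norm// invf_lt1// ltr1n.
  move/cvgrPdist_lt => /(_ d d0)[N _ NP]; exists N.
  by have /= := NP N (leqnn N); rewrite sub0r normrN; apply: le_lt_trans; exact: ler_norm.
have {x y xa ax yb yb2 x0x xx0 y0y yy0}
  [x [y [Dn /andP[xa ax] /andP[yb yb2] [x0x xx0] [y0y yy0]]]] := abP n.
set h := dx / 2 ^+ n in Dn ax xx0; set k := dy / 2 ^+ n in Dn yb2 yy0.
have h0 : 0 < h by rewrite divr_gt0// exprn_gt0.
have k0 : 0 < k by rewrite divr_gt0// exprn_gt0.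
have hkd : h + k < d by rewrite /h /k -mulrDl.
set e := eta / _ in dP.
have e0 : 0 < e by rewrite divr_gt0// mulr_gt0.
have inx x' : x <= x' <= x + h -> x0 <= x' <= x0 + dx /\ `|x' - a| <= h.
  clear -xa ax x0x xx0; move=> /andP[? ?]; rewrite ler_norml.
  by split; apply/andP; split; lra.
have iny y' : y <= y' <= y + k -> y0 <= y' <= y0 + dy /\ `|y' - b| <= k.
  clear -yb yb2 y0y yy0; move=> /andP[? ?]; rewrite ler_norml.
  by split; apply/andP; split; lra.
have hd : h < d by apply: le_lt_trans hkd; rewrite lerDl ltW.
have kd : k < d by apply: le_lt_trans hkd; rewrite lerDr ltW.
have : `|M x y h k| <= 2 * (e * (h + k) * (h + k)).
  have := @small_rectangle_le P Q PP QQ x y h k a b p1 p2 q2 (e * (h + k))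
    (ltW h0) (ltW k0).
  have -> : QQ (x + h) (y + k) - QQ (x + h) y - (QQ x (y + k) - QQ x y)
    - (PP (x + h) (y + k) - PP x (y + k) - (PP (x + h) y - PP x y)) = M x y h k.
    by rewrite /M /K; ring.
  apply.
  - move=> x' y' /inx[x'P _] /iny[y'P _]; exact: dPQ.
  - move=> x' y' /inx[x'P nx] /iny[y'P ny].
    have [A B] := dP x' y' x'P y'P (le_lt_trans nx hd) (le_lt_trans ny kd).
    have C : e * (`|x' - a| + `|y' - b|) <= e * (h + k) by rewrite ler_pM2l// lerD.
    by split; [exact: le_trans A C|exact: le_trans B C].
apply: contraTT => _; rewrite -ltNge; apply: lt_le_trans Dn.
have hk : h + k = (dx + dy) / 2 ^+ n by rewrite /h /k -mulrDl.
have -> : 2 * (e * (h + k) * (h + k)) = 2 / 3 * (eta / 4 ^+ n).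
  have -> : (4 : R) ^+ n = 2 ^+ n * 2 ^+ n by rewrite -exprMn; congr (_ ^+ _); lra.
  rewrite hk /e; field; rewrite expf_neq0//=.
  by rewrite gt_eqF// addr_gt0.
have : 0 < eta / 4 ^+ n by rewrite divr_gt0// exprn_gt0.
by clear; lra.
Qed.

End RealGoursat.

(** * Modulus of a complex number, and complex derivatives in real coordinates *)

Section Cmod.
Variable R : realType.
Implicit Types z w : R[i].

Lemma cmodE z : cmod z = Num.sqrt (complex.Re z ^+ 2 + complex.Im z ^+ 2).
Proof. by rewrite /cmod normc_def. Qed.

Lemma cmod_norm z : `|z| = (cmod z)%:C.
Proof. by rewrite /cmod normc_def. Qed.

Lemma cmod_ge0 z : 0 <= cmod z.
Proof. by rewrite cmodE sqrtr_ge0. Qed.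

Lemma sqr_cmod z : cmod z ^+ 2 = complex.Re z ^+ 2 + complex.Im z ^+ 2.
Proof. by rewrite cmodE sqr_sqrtr// addr_ge0// sqr_ge0. Qed.

Lemma cmodM z w : cmod (z * w) = cmod z * cmod w.
Proof. by apply: complexI; rewrite -cmod_norm normrM !cmod_norm rmorphM. Qed.

Lemma cmodD z w : cmod (z + w) <= cmod z + cmod w.
Proof. by rewrite -lecR rmorphD/= -!cmod_norm ler_normD. Qed.

Lemma cmodN z : cmod (- z) = cmod z.
Proof. by rewrite /cmod normrN. Qed.

Lemma cmodV z : cmod z^-1 = (cmod z)^-1.
Proof. by apply: complexI; rewrite -cmod_norm normfV !cmod_norm fmorphV. Qed.

Lemma cmod_real (a : R) : cmod a%:C = `|a|.
Proof. by rewrite cmodE/= expr0n/= addr0 sqrtr_sqr. Qed.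

Lemma cmod0 : cmod (0 : R[i]) = 0.
Proof. by rewrite /cmod normr0. Qed.

Lemma cmod1 : cmod (1 : R[i]) = 1.
Proof. by rewrite /cmod normr1. Qed.

Lemma cmod_conj z : cmod z^* = cmod z.
Proof. by rewrite /cmod normcJ. Qed.

Lemma cmod_eq0 z : (cmod z == 0) = (z == 0).
Proof. by rewrite -(normr_eq0 z) cmod_norm -(inj_eq (@complexI R)). Qed.

Lemma cmod_gt0 z : (0 < cmod z) = (z != 0).
Proof. by rewrite lt_neqAle cmod_ge0 andbT eq_sym cmod_eq0. Qed.

Lemma cmodX z n : cmod (z ^+ n) = cmod z ^+ n.
Proof. by elim: n => [|n IH]; rewrite ?expr0 ?cmod1// !exprS cmodM IH. Qed.

Lemma Re_le_cmod z : `|complex.Re z| <= cmod z.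
Proof. by rewrite cmodE -sqrtr_sqr ler_wsqrtr// lerDl sqr_ge0. Qed.

Lemma Im_le_cmod z : `|complex.Im z| <= cmod z.
Proof. by rewrite cmodE -sqrtr_sqr ler_wsqrtr// lerDr sqr_ge0. Qed.

Lemma cmod_le_ReIm (a b : R) : cmod (a +i* b) <= `|a| + `|b|.
Proof.
rewrite -[leRHS]ger0_norm ?addr_ge0// -sqrtr_sqr cmodE ler_wsqrtr//=.
rewrite sqrrD !real_normK ?num_real// -addrA lerD2l lerDr.
by rewrite mulrn_wge0// mulr_ge0.
Qed.

Lemma mulc_conj z : z * z^* = (cmod z ^+ 2)%:C.
Proof. by rewrite -sqr_normc cmod_norm rmorphXn. Qed.

End Cmod.

Section Schwarz.
Variable R : realType.
Local Notation C := R[i].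

(** Complex differentiability in the form of an estimate with real constants; this
is the form in which real and imaginary parts can be separated. *)
Definition cderiv (f : C -> C) (z c : C) := forall e : R, 0 < e -> exists2 d : R,
  0 < d & forall w, cmod (w - z) < d ->
    cmod (f w - f z - c * (w - z)) <= e * cmod (w - z).

(** The map (x, y) |-> G x y is complex differentiable with derivative [m] when
the plane is identified with C by (x, y) |-> x + i y. *)
Definition xyderiv (G : R -> R -> C) (a b : R) (m : C) :=
  forall e : R, 0 < e -> exists2 d : R, 0 < d & forall x y,
    `|x - a| < d -> `|y - b| < d ->
    cmod (G x y - G a b - m * ((x - a) +i* (y - b))) <= e * (`|x - a| + `|y - b|).

Lemma xyderiv_lip G a b m : xyderiv G a b m -> exists2 d : R, 0 < d & forall x y,
  `|x - a| < d -> `|y - b| < d ->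
  cmod (G x y - G a b) <= (cmod m + 1) * (`|x - a| + `|y - b|).
Proof.
move=> /(_ 1 ltr01)[d d0 dP]; exists d => // x y xa yb.
have := dP _ _ xa yb; rewrite mul1r => H.
rewrite -(subrK (m * ((x - a) +i* (y - b))) (G x y - _)).
apply: le_trans (cmodD _ _) _.
rewrite mulrDl mul1r cmodM addrC lerD// ler_wpM2l ?cmod_ge0//.
exact: cmod_le_ReIm.
Qed.

Lemma xyderiv_comp f G a b m c : cderiv f (G a b) c -> xyderiv G a b m ->
  xyderiv (fun x y => f (G x y)) a b (c * m).
Proof.
move=> df dG e e0.
have [d1 d10 lip] := xyderiv_lip dG.
have L0 : 0 < cmod m + 1 by rewrite ltr_wpDl ?cmod_ge0.
have c10 : 0 < cmod c + 1 by rewrite ltr_wpDl ?cmod_ge0.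
have [|d2 d20 d2P] := df (e / 2 / (cmod m + 1)); first by rewrite !divr_gt0.
have [|d3 d30 d3P] := dG (e / 2 / (cmod c + 1)); first by rewrite !divr_gt0.
exists (Num.min d1 (Num.min d3 (d2 / (cmod m + 1) / 2))).
  by rewrite !lt_min d10 d30 !divr_gt0.
move=> x y; rewrite !lt_min => /and3P[x1 x3 x2] /and3P[y1 y3 y2].
have l := lip _ _ x1 y1; have g := d3P _ _ x3 y3.
have Gd : cmod (G x y - G a b) < d2.
  apply: le_lt_trans l _; rewrite -ltr_pdivlMl// mulrC.
  by rewrite [ltRHS]splitr ltrD.
have := d2P _ Gd => H.
rewrite (_ : _ - _ = (f (G x y) - f (G a b) - c * (G x y - G a b))
  + c * (G x y - G a b - m * ((x - a) +i* (y - b)))); last by ring.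
apply: le_trans (cmodD _ _) _; rewrite (splitr e) mulrDl lerD//.
  apply: le_trans H _.
  apply: (@le_trans _ _ (e / 2 / (cmod m + 1) * ((cmod m + 1) * (`|x - a| + `|y - b|)))).
    by apply: ler_wpM2l => //; rewrite ltW// !divr_gt0.
  by rewrite mulrA divfK ?gt_eqF.
rewrite cmodM; apply: (@le_trans _ _ ((cmod c + 1) * (e / 2 / (cmod c + 1) * (`|x - a| + `|y - b|)))).
  by apply: ler_pM; rewrite ?cmod_ge0// lerDl.
by rewrite mulrA (mulrC (cmod c + 1)) divfK ?gt_eqF.
Qed.

Lemma xyderivM F G a b m n : xyderiv F a b m -> xyderiv G a b n ->
  xyderiv (fun x y => F x y * G x y) a b (m * G a b + F a b * n).
Proof.
move=> dF dG e e0.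
have [d1 d10 l1] := xyderiv_lip dF; have [d2 d20 l2] := xyderiv_lip dG.
have m0 := cmod_ge0 m; have n0 := cmod_ge0 n.
have F0 := cmod_ge0 (F a b); have G0 := cmod_ge0 (G a b).
pose B := cmod m + 1 + (cmod n + 1) + (cmod (F a b) + 1) + (cmod (G a b) + 1).
have B0 : 0 < B by rewrite /B; lra.
have e30 : 0 < e / 3 / B by rewrite !divr_gt0.
have [d3 d30 d3P] := dF _ e30; have [d4 d40 d4P] := dG _ e30.
have d50 : 0 < e / 3 / B / B / 2 by rewrite !divr_gt0.
exists (Num.min d1 (Num.min d2 (Num.min d3 (Num.min d4 (e / 3 / B / B / 2))))).
  by rewrite !lt_min d10 d20 d30 d40.
move=> x y; rewrite !lt_min => /and5P[x1 x2 x3 x4 x5] /and5P[y1 y2 y3 y4 y5].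
have A1 := l1 _ _ x1 y1; have A2 := l2 _ _ x2 y2.
have A3 := d3P _ _ x3 y3; have A4 := d4P _ _ x4 y4.
set s := x - a in x5 A1 A2 A3 A4 *; set t := y - b in y5 A1 A2 A3 A4 *.
rewrite (_ : _ - _ = (F x y - F a b - m * (s +i* t)) * G a b
  + F a b * (G x y - G a b - n * (s +i* t)) +
  (F x y - F a b) * (G x y - G a b)); last by ring.
have N0 : 0 <= `|s| + `|t| by rewrite addr_ge0.
set N := `|s| + `|t| in A1 A2 A3 A4 N0 *.
apply: le_trans (cmodD _ _) _.
rewrite (_ : e * N = e / 3 / B * N * B + e / 3 / B * N * B + e / 3 / B * N * B); last first.
  by field; rewrite gt_eqF.
apply: lerD; first (apply: le_trans (cmodD _ _) _; apply: lerD).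
- rewrite cmodM; apply: ler_pM; rewrite ?cmod_ge0//.
  by rewrite /B; lra.
- rewrite cmodM mulrC; apply: ler_pM; rewrite ?cmod_ge0//.
  by rewrite /B; lra.
- rewrite cmodM; apply: (@le_trans _ _ (B * N * (B * N))).
    apply: ler_pM; rewrite ?cmod_ge0//.
      by apply: le_trans A1 _; apply: ler_wpM2r => //; rewrite /B; lra.
    by apply: le_trans A2 _; apply: ler_wpM2r => //; rewrite /B; lra.
  have NB : B * N <= e / 3 / B.
    by rewrite mulrC -ler_pdivlMr// (splitr (_ / B / B)) lerD// ltW.
  rewrite -[leRHS]mulrA [in X in _ * X <= _](mulrC B).
  by apply: ler_wpM2r => //; rewrite mulr_ge0// ltW.
Qed.

End Schwarz.

(** * The Schwarz lemma at the origin *)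

Lemma is_derive_eps (K : numFieldType) (W : normedModType K) (f : K -> W)
    (x : K) (l : W) : is_derive x 1 f l -> forall e : K, 0 < e ->
  exists2 d : K, 0 < d & forall y, `|y - x| < d ->
    `|f y - f x - (y - x) *: l| <= e * `|y - x|.
Proof.
move=> [/derivable_nbhs + <-] e e0 => /eqaddoP/(_ _ e0)[d /= d0 dP].
exists d => // y yd.
have /= := dP (y - x); rewrite /ball_/= sub0r normrN => /(_ yd).
rewrite !fctE /= [(y - x)%:A]mulr1 subrK.
by rewrite opprD addrA.
Qed.

Section Schwarz.
Variable R : realType.
Local Notation C := R[i].
Implicit Types (x y a b : R) (z w : C).

(** The exponential of x + i y; x is the logarithm of the modulus, y an argument. *)
Definition polar x y : C := (expR x * cos y) +i* (expR x * sin y).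

Lemma polarD x y a b : polar (x + a) (y + b) = polar x y * polar a b.
Proof.
by rewrite /polar expRD cosD sinD; apply/eqP; rewrite eq_complex/=; apply/andP; split;
  apply/eqP; ring.
Qed.

Lemma cmod_polar x y : cmod (polar x y) = expR x.
Proof.
rewrite cmodE/= !exprMn -mulrDr cos2Dsin2 mulr1 sqrtr_sqr ger0_norm//.
Qed.

Lemma polar0 : polar 0 0 = 1.
Proof. by rewrite /polar expR0 cos0 sin0 mulr0 mulr1. Qed.

Lemma polarN x y : polar (- x) (- y) * polar x y = 1.
Proof. by rewrite -polarD !addNr polar0. Qed.

Lemma polar2pi x : polar x (pi *+ 2) = polar x 0.
Proof. by rewrite /polar cos2pi sin2pi cos0 sin0. Qed.

Lemma xyderiv_polar0 : xyderiv polar 0 0 1.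
Proof.
move=> e e0.
pose k := Num.min 1 (e / 5).
have k0 : 0 < k by rewrite lt_min ltr01 divr_gt0.
have k1 : k <= 1 by rewrite ge_min lexx.
have ke : k <= e / 5 by rewrite ge_min lexx orbT.
clearbody k.
have [d1 d10 D1] := is_derive_eps (is_derive_expR (0 : R)) k0.
have [d2 d20 D2] := is_derive_eps (is_derive_cos (0 : R)) k0.
have [d3 d30 D3] := is_derive_eps (is_derive_sin (0 : R)) k0.
exists (Num.min k (Num.min d1 (Num.min d2 d3))).
  by rewrite !lt_min k0 d10 d20 d30.
move=> s t; rewrite !subr0 !lt_min => /and4P[sk s1 _ _] /and4P[tk _ t2 t3].
have := D1 s; have := D2 t; have := D3 t.
rewrite !subr0 => /(_ t3) + /(_ t2) + /(_ s1).
rewrite expR0 cos0 sin0 /GRing.scale/= ?oppr0 ?mulr1 ?mulr0 ?subr0 ?addr0 polar0 mul1r.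
rewrite /polar.
have := cos_max t; have := sin_max t.
move: (expR s) (cos t) (sin t) => E c sn sn1 c1 Hs Hc HE.
have -> : E * c +i* (E * sn) - 1 - s +i* t
  = ((E - 1 - s) * c + (1 + s) * (c - 1))
    +i* ((E - 1 - s) * sn + (1 + s) * (sn - t) + s * t).
  by apply/eqP; rewrite eq_complex/=; apply/andP; split; apply/eqP; ring.
apply: le_trans (cmod_le_ReIm _ _) _.
have s2 : `|1 + s| <= 2.
  by rewrite (le_trans (ler_normD _ _))// normr1 -[2]/(1 + 1) lerD2l (le_trans (ltW sk)).
have bnd (p q r u : R) : `|p| <= q -> `|r| <= u -> `|p * r| <= q * u.
  by move=> ? ?; rewrite normrM ler_pM.
have A1 := bnd _ _ _ _ HE c1; have A2 := bnd _ _ _ _ HE sn1.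
have A3 := bnd _ _ _ _ s2 Hc; have A4 := bnd _ _ _ _ s2 Hs.
have A5 := bnd _ _ _ _ (ltW sk) (lexx `|t|).
have A6 : k * `|s| <= e / 5 * `|s| by rewrite ler_wpM2r.
have A7 : k * `|t| <= e / 5 * `|t| by rewrite ler_wpM2r.
have N1 := ler_normD ((E - 1 - s) * c) ((1 + s) * (c - 1)).
have N2 := ler_normD ((E - 1 - s) * sn + (1 + s) * (sn - t)) (s * t).
have N3 := ler_normD ((E - 1 - s) * sn) ((1 + s) * (sn - t)).
have es : 0 <= e / 5 * `|s| by rewrite mulr_ge0// divr_ge0// ltW.
have -> : e * (`|s| + `|t|) = 5 * (e / 5 * `|s|) + 5 * (e / 5 * `|t|) by field.
clear -A1 A2 A3 A4 A5 A6 A7 N1 N2 N3 es; lra.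
Qed.

Lemma xyderiv_polar a b : xyderiv polar a b (polar a b).
Proof.
move=> e e0; have p0 : 0 < cmod (polar a b) by rewrite cmod_polar expR_gt0.
have [|d d0 dP] := @xyderiv_polar0 (e / cmod (polar a b)); first by rewrite divr_gt0.
exists d => // x y xa yb.
have := dP (x - a) (y - b); rewrite !subr0 => /(_ xa yb) H.
(* the addition formula reduces the claim to the origin *)
have -> : polar x y = polar a b * polar (x - a) (y - b).
  by rewrite -polarD !subrKC.
rewrite polar0 mul1r in H.
rewrite (_ : _ - _ = polar a b * (polar (x - a) (y - b) - 1 - (x - a) +i* (y - b))); last by ring.
rewrite cmodM; apply: le_trans (ler_wpM2l (ltW p0) H) _.
by rewrite mulrA (mulrC (cmod (polar a b))) divfK ?gt_eqF.
Qed.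

Lemma xyderiv_polarN a b :
  xyderiv (fun x y => polar (- x) (- y)) a b (- polar (- a) (- b)).
Proof.
move=> e e0; have [d d0 dP] := @xyderiv_polar (- a) (- b) _ e0.
exists d => // x y xa yb; have := dP (- x) (- y).
have -> : - x - - a = - (x - a) by ring.
have -> : - y - - b = - (y - b) by ring.
rewrite !normrN => /(_ xa yb).
rewrite (_ : (- (x - a)) +i* (- (y - b)) = - ((x - a) +i* (y - b)))//.
by rewrite mulrN mulNr.
Qed.

Lemma xyderiv_continuous G a b m : xyderiv G a b m ->
  {for a, continuous (fun x => complex.Im (G x b))} /\
  {for b, continuous (fun y => complex.Re (G a y))}.
Proof.
move=> /xyderiv_lip[d d0 dP].
have L0 : 0 < cmod m + 1 by rewrite ltr_wpDl ?cmod_ge0.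
have nr (c r : R) : 0 < r -> \forall t \near c, `|t - c| < r.
  by move=> r0; apply/nbhs_ballP; exists r => //= t; rewrite /ball/= distrC.
split; apply/cvgrPdist_lt => e e0; near=> t.
- have td : `|t - a| < d by near: t; exact: nr.
  have te : `|t - a| < e / (cmod m + 1) by near: t; apply: nr; rewrite divr_gt0.
  rewrite distrC -raddfB; apply: le_lt_trans (Im_le_cmod _) _.
  have := dP t b td; rewrite subrr normr0 addr0 => /(_ d0) /le_lt_trans; apply.
  by rewrite mulrC -ltr_pdivlMr.
- have td : `|t - b| < d by near: t; exact: nr.
  have te : `|t - b| < e / (cmod m + 1) by near: t; apply: nr; rewrite divr_gt0.
  rewrite distrC -raddfB; apply: le_lt_trans (Re_le_cmod _) _.
  have := dP a t; rewrite subrr normr0 add0r => /(_ d0 td) /le_lt_trans; apply.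
  by rewrite mulrC -ltr_pdivlMr.
Unshelve. all: by end_near. Qed.

(** The Cauchy-Riemann equations: for a complex differentiable G the form
Im G dx + Re G dy is closed, since the y-slope of Im G and the x-slope of Re G
are both equal to the real part of the derivative. *)
Lemma xyderiv_forms G a b m : xyderiv G a b m ->
  exists p1 p2 q2 : R, forall e : R, 0 < e -> exists2 d : R, 0 < d &
    forall x y, `|x - a| < d -> `|y - b| < d ->
      `|complex.Im (G x y) - complex.Im (G a b) - p1 * (x - a) - p2 * (y - b)|
        <= e * (`|x - a| + `|y - b|) /\
      `|complex.Re (G x y) - complex.Re (G a b) - p2 * (x - a) - q2 * (y - b)|
        <= e * (`|x - a| + `|y - b|).
Proof.
case: m => m1 m2 dG; exists m2, m1, (- m2) => e e0.
have [d d0 dP] := dG _ e0; exists d => // x y xa yb.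
have H := dP _ _ xa yb; move: H (Re_le_cmod (G x y - G a b - (m1 +i* m2) * ((x - a) +i* (y - b))))
  (Im_le_cmod (G x y - G a b - (m1 +i* m2) * ((x - a) +i* (y - b)))).
case: (G x y) (G a b) => [u v] [u0 v0] H /= A B; split.
- apply: le_trans H; apply: le_trans B; rewrite le_eqVlt; apply/orP; left.
  by apply/eqP; congr `|_|; ring.
- apply: le_trans H; apply: le_trans A; rewrite le_eqVlt; apply/orP; left.
  by apply/eqP; congr `|_|; ring.
Qed.

(** The mean of Re H over the vertical segment of length 2 pi at abscissa x is
independent of x: Goursat's theorem applies to Im H dx + Re H dy on
[x0, x1] x [0, 2 pi], and the horizontal sides cancel by periodicity.  A lower
bound of Re H at x0 is therefore at most an upper bound of Re H at x1. *)
Lemma mean_value_le (H : R -> R -> C) (x0 x1 lo hi : R) : x0 < x1 -> x1 < 0 ->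
    (forall x y, x < 0 -> exists m, xyderiv H x y m) ->
    (forall x, H x (pi *+ 2) = H x 0) ->
    (forall y, lo <= complex.Re (H x0 y)) ->
    (forall y, complex.Re (H x1 y) <= hi) ->
  lo <= hi.
Proof.
move=> x01 x10 dH per Hlo Hhi.
have pi20 : 0 < pi *+ 2 :> R by rewrite mulrn_wgt0// pi_gt0.
have /choice[PP PPp] (u : R -> R) : exists U : R -> R,
   (forall x, x < 0 -> {for x, continuous u}) ->
   (forall x, x0 - 1 < x < 0 -> is_derive x 1 U (u x)).
  have [cu|cu] := pselect (forall x, x < 0 -> {for x, continuous u}); last by exists u.
  by have [U UP] := continuous_has_primitive (x0 - 1) cu; exists U.
have /choice[QQ QQp] (u : R -> R) : exists U : R -> R,
   continuous u -> (forall y, 0 <= y <= 0 + pi *+ 2 -> is_derive y 1 U (u y)).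
  have [cu|cu] := pselect (continuous u); last by exists u.
  have [|U UP] := @continuous_has_primitive R u (-1) (0 + pi *+ 2 + 1); first by move=> x _; exact: cu.
  exists U => _ y /andP[y0 y1]; apply: UP; apply/andP; split.
    by apply: lt_le_trans y0; rewrite oppr_lt0.
  by apply: le_lt_trans y1 _; rewrite ltrDl.
have dx0 : 0 < x1 - x0 by rewrite subr_gt0.
have cI y x : x < 0 -> {for x, continuous (fun x => complex.Im (H x y))}.
  by move=> /(dH _ y)[m /xyderiv_continuous[]].
have cR x : x < 0 -> continuous (fun y => complex.Re (H x y)).
  by move=> xn y; have [m /xyderiv_continuous[]] := dH _ y xn.
have in_neg x : x0 <= x <= x0 + (x1 - x0) -> x0 - 1 < x < 0.
  by move=> /andP[a1 a2]; apply/andP; split; lra.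
have := @goursat_rectangle R (fun x y => complex.Im (H x y))
  (fun x y => complex.Re (H x y)) (fun x y => PP (fun x => complex.Im (H x y)) x)
  (fun x y => QQ (fun y => complex.Re (H x y)) y) x0 0 (x1 - x0) (pi *+ 2) dx0 pi20.
rewrite add0r (_ : x0 + (x1 - x0) = x1); last by ring.
have -> : (fun x => complex.Im (H x (pi *+ 2))) = (fun x => complex.Im (H x 0)).
  by apply/funext => x; rewrite per.
rewrite subrr => K; have {K} : QQ (fun y => complex.Re (H x1 y)) (pi *+ 2) -
  QQ (fun y => complex.Re (H x1 y)) 0 - (QQ (fun y => complex.Re (H x0 y)) (pi *+ 2) -
  QQ (fun y => complex.Re (H x0 y)) 0) = 0.
  apply: K => [x y xP yP|a b aP bP].
    have /andP[? xn] : x0 - 1 < x < 0 by apply: in_neg; rewrite subrKC.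
    split; first by apply: PPp; [exact: cI|apply/andP].
    by apply: QQp; [exact: cR|rewrite add0r].
  have /andP[? an] : x0 - 1 < a < 0 by apply: in_neg; rewrite subrKC.
  have [m /xyderiv_forms[p1 [p2 [q2 pP]]]] := dH a b an.
  exists p1, p2, q2 => e /pP[d d0 dP]; exists d => // x y _ _; exact: dP.
move: (QQ _) (QQp _ (cR _ x10)) => U1 dU1.
move: (QQ _) (QQp _ (cR _ (lt_trans x01 x10))) => U0 dU0 E.
have W (U u : R -> R) : (forall y, 0 <= y <= 0 + pi *+ 2 -> is_derive y 1 U (u y)) ->
   (forall y, 0 <= u y) -> U 0 <= U (pi *+ 2).
  move=> dU u0; have [||c _ Uc] := @MVT_segment R U u 0 (pi *+ 2) (ltW pi20).
  - move=> y; rewrite in_itv/= => /andP[y1 y2]; apply: dU.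
    by rewrite add0r !ltW.
  - apply: derivable_within_continuous => y; rewrite in_itv/= => yP.
    by have [] := dU y; rewrite ?add0r.
  - by rewrite -subr_ge0 Uc subr0 mulr_ge0// ltW.
have A1 : hi * 0 - U1 0 <= hi * (pi *+ 2) - U1 (pi *+ 2).
  apply: (W (fun y => hi * y - U1 y) (fun y => hi - complex.Re (H x1 y))) => y; last by rewrite subr_ge0.
  by move=> /dU1 d1; apply: is_derive_eq; rewrite /GRing.scale/= mulr1.
have A0 : U0 0 - lo * 0 <= U0 (pi *+ 2) - lo * (pi *+ 2).
  apply: (W (fun y => U0 y - lo * y) (fun y => complex.Re (H x0 y) - lo)) => y; last by rewrite subr_ge0.
  by move=> /dU0 d1; apply: is_derive_eq; rewrite /GRing.scale/= mulr1.
rewrite -(ler_pM2r pi20).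
move: A0 A1 E; rewrite /= !mulr0 => A0 A1 E; clear -A0 A1 E; lra.
Qed.

(** The function f(z)/z is compared on a very small circle, where it is close to
f'(0), with its values on a circle of radius close to 1, where its modulus is
at most the inverse of the radius. *)
Lemma schwarz_derivative_real (f : C -> C) (c : R) :
    (forall z, cmod z < 1 -> exists d, cderiv f z d) ->
    (forall z, cmod z < 1 -> cmod (f z) <= 1) ->
    f 0 = 0 -> cderiv f 0 c%:C -> c <= 1.
Proof.
move=> df f1 f0 dc; rewrite leNgt; apply/negP => c1.
(* the circle of radius 1/q, on which f(z)/z is bounded by q < c *)
pose q := (c + 1) / 2.
have q0 : 1 < q by rewrite /q; lra.
pose x1 := - ln q.
have Ex1 : expR (- x1) = q by rewrite opprK lnK// posrE; lra.
have x10 : x1 < 0 by rewrite oppr_lt0 ln_gt0.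
have [|d d0 dP] := dc ((c - 1) / 4); first by rewrite divr_gt0// subr_gt0.
pose x0 := Num.min (x1 - 1) (ln (d / 2)).
have x01 : x0 < x1 by rewrite gt_min ltrBlDr ltrDl ltr01.
have Ex0 : expR x0 < d.
  apply: (@le_lt_trans _ _ (d / 2)).
    by rewrite -[leRHS]lnK ?posrE ?divr_gt0// ler_expR ge_min lexx orbT.
  by rewrite ltr_pdivrMr// ltr_pMr// ltr1n.
have pE x y : x < 0 -> cmod (polar x y) < 1 by move=> xn; rewrite cmod_polar expR_lt1.
suff : c - (c - 1) / 4 <= q by rewrite /q; lra.
apply: (@mean_value_le (fun x y => f (polar x y) * polar (- x) (- y)) x0 x1) => //.
- move=> x y xn; have [m dm] := df _ (pE x y xn); eexists.
  apply: xyderivM; last exact: xyderiv_polarN.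
  by apply: xyderiv_comp dm _; exact: xyderiv_polar.
- move=> x; rewrite polar2pi; congr (_ * _).
  by rewrite /polar !cosN !sinN cos2pi sin2pi cos0 sin0.
- move=> y; have := dP (polar x0 y); rewrite subr0 f0 subr0 cmod_polar => /(_ Ex0) H.
  have := @ler_wpM2r _ (expR (- x0)) (expR_ge0 _) _ _ H.
  have E : expR x0 * expR (- x0) = 1 by rewrite -expRD subrr expR0.
  rewrite -[X in _ <= X]mulrA E mulr1 -(cmod_polar (- x0) (- y)) -cmodM.
  rewrite mulrBl -mulrA (mulrC (polar x0 y)) polarN mulr1 => /(le_trans (Re_le_cmod _)).
  rewrite raddfB/= => /ler_normlP[+ _]; lra.
- move=> y; apply: le_trans (ler_norm _) _; apply: le_trans (Re_le_cmod _) _.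
  rewrite cmodM cmod_polar Ex1 ler_piMl ?f1 ?pE//; lra.
Qed.

Lemma schwarz_derivative (f : C -> C) (c : C) :
    (forall z, cmod z < 1 -> exists d, cderiv f z d) ->
    (forall z, cmod z < 1 -> cmod (f z) <= 1) ->
    f 0 = 0 -> cderiv f 0 c -> cmod c <= 1.
Proof.
move=> df f1 f0 dc.
have [->|c0] := eqVneq c 0; first by rewrite cmod0 ler01.
have cc0 : cmod c != 0 by rewrite cmod_eq0.
(* a rotation makes the derivative at 0 real and nonnegative *)
pose k : C := c^* / (cmod c)%:C.
have k1 : cmod k = 1 by rewrite cmodM cmodV cmod_conj cmod_real ger0_norm ?cmod_ge0// divff.
have kc : k * c = (cmod c)%:C.
  rewrite mulrAC (mulrC _ c) mulc_conj -fmorphV -rmorphM; congr _%:C.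
  by rewrite expr2 mulfK.
have kd z d : cderiv f z d -> cderiv (fun z => k * f z) z (k * d).
  move=> H e /H[r r0 rP]; exists r => // w /rP /=.
  rewrite (_ : k * f w - k * f z - k * d * (w - z) = k * (f w - f z - d * (w - z))); last by ring.
  by rewrite cmodM k1 mul1r.
apply: (@schwarz_derivative_real (fun z => k * f z)).
- by move=> z /df[d /kd]; exists (k * d).
- by move=> z /f1; rewrite cmodM k1 mul1r.
- by rewrite f0 mulr0.
- by rewrite -kc; exact: kd.
Qed.

End Schwarz.

(** * Analytic discs and their tangent vectors *)

Section Discs.
Variable R : realType.
Local Notation C := R[i].
Local Notation V n := ('rV[R[i]]_n : normedModType R[i]).

Lemma differentiable_cderiv (f : C^o -> C^o) (z : C) :
  differentiable f (z : C^o) -> cderiv f z ('d f (z : C^o) 1).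
Proof.
move=> df e e0.
have dd : is_derive (z : C^o) (1 : C^o) f ('d f (z : C^o) 1).
  by rewrite -deriveE//; apply/derivableP; exact: diff_derivable.
have [|d d0 dP] := @is_derive_eps C C^o f z _ dd e%:C.
  by rewrite ltcR.
have dE : d = (complex.Re d)%:C.
  by apply/esym/RRe_real; rewrite realE ltW.
exists (complex.Re d); first by rewrite -ltcR -dE.
move=> w wz; have := dP w; rewrite cmod_norm dE ltcR => /(_ wz).
by rewrite !cmod_norm -rmorphM lecR /GRing.scale/= (mulrC (w - z)).
Qed.

(** This is the indicatrix of the Kobayashi metric of [D] at [p]. *)
Definition disc_tangent n (D : set (V n)) (p v : V n) : Prop :=
  exists phi : C^o -> V n,
    [/\ forall z : C, cmod z < 1 -> D (phi z) /\ differentiable phi (z : C^o),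
        phi 0 = p & 'd phi (0 : C^o) 1 = v].

Lemma disc_tangent_push m n (D : set (V m)) (E : set (V n))
    (f : V m -> V n) p v :
  holomorphic_on D f -> (forall x, D x -> E (f x)) ->
  disc_tangent D p v -> disc_tangent E (f p) ('d f p v).
Proof.
move=> hf DE [phi [phiD phi0 phi1]]; exists (f \o phi); split.
- move=> z /phiD[Dz dz]; split; first exact: DE.
  by apply: differentiable_comp => //; exact: hf.
- by rewrite /= phi0.
- have c0 : cmod (0 : C) < 1 by rewrite cmod0.
  have [D0 d0] := phiD 0 c0.
  by rewrite diff_comp/= ?phi0 ?phi1//; apply: hf; rewrite -phi0.
Qed.

(** The composition of [g] with a disc is a bounded function on the unit disc, to
which the Schwarz lemma applies. *)
Lemma disc_tangent_schwarz n (D : set (V n)) (g : V n -> C^o) p v :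
  (forall x, D x -> differentiable g x /\ cmod (g x) <= 1) -> g p = 0 ->
  disc_tangent D p v -> cmod ('d g p v) <= 1.
Proof.
move=> hg gp [phi [phiD phi0 phi1]].
have dgphi (z : C) : cmod z < 1 -> differentiable (g \o phi) (z : C^o).
  by move=> /phiD[/hg[? _] ?]; exact: differentiable_comp.
have c0 : cmod (0 : C) < 1 by rewrite cmod0.
have [/hg[dg0 _] d0] := phiD 0 c0.
have <- : 'd (g \o phi) (0 : C^o) 1 = 'd g p v by rewrite diff_comp//= phi0 phi1.
apply: (@schwarz_derivative R (g \o phi)).
- by move=> z z1; eexists; apply: differentiable_cderiv; exact: dgphi.
- by move=> z /phiD[/hg[]].
- by rewrite /= phi0.
- by apply: differentiable_cderiv; exact: dgphi.
Qed.

(** The differentials of elementary maps are stated together with their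
differentiability, so that both can be used at once for the discs and the
projective transformations below. *)
Lemma diff_coord n (M : V n) (j : 'I_n) :
  differentiable (fun x : V n => x 0 j : C^o) M /\
  forall v, 'd (fun x : V n => x 0 j : C^o) M v = v 0 j.
Proof.
split; first exact: differentiable_coord.
pose c (x : V n) : C^o := x 0 j.
have cl : linear c by move=> a x y; rewrite /c !mxE.
pose cL : {linear V n -> C^o} := HB.pack c (GRing.isLinear.Build _ _ _ _ c cl).
by move=> v; rewrite (_ : (fun _ => _) = cL)// diff_lin//; exact: coord_continuous.
Qed.

Lemma differentiable_row (U : normedModType C) n (F : 'I_n -> U -> C^o) (z : U) :
  (forall i, differentiable (F i) z) ->
  differentiable (fun w => \row_i F i w : V n) z /\
  forall v, 'd (fun w => \row_i F i w : V n) z v = \row_i 'd (F i) z v.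
Proof.
move=> dF.
pose E i : V n := delta_mx 0 i.
have rowE : (fun w => \row_i F i w : V n) = \sum_(i < n) (fun w => F i w *: E i).
  apply/funext => w; rewrite fct_sumE; apply/rowP => j.
  rewrite !mxE summxE (bigD1 j)//= !mxE !eqxx mulr1 big1 ?addr0// => i ij.
  by rewrite !mxE eqxx eq_sym (negbTE ij) mulr0.
have d1 i : differentiable (fun w => F i w *: E i) z by exact: differentiableZl.
have dr : differentiable (fun w => \row_i F i w : V n) z.
  by rewrite rowE; apply: differentiable_sum.
split => // v; apply/rowP => j; rewrite mxE.
have [dc dcE] := @diff_coord n (\row_i F i z) j.
have cF : F j = (fun x : V n => x 0 j : C^o) \o (fun w => \row_i F i w).
  by apply/funext => w; rewrite /= mxE.
by rewrite [in RHS]cF diff_comp//= dcE.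
Qed.

Lemma diff_mulmx m n (A : 'M[C]_(m, n)) (x : V m) :
  differentiable (fun y : V m => y *m A : V n) x /\
  forall v, 'd (fun y : V m => y *m A : V n) x v = v *m A.
Proof.
have dj (j : 'I_n) (y : V m) : differentiable (fun y : V m => (y *m A) 0 j : C^o) y.
  have -> : (fun y : V m => (y *m A) 0 j : C^o) =
     \sum_(i < m) (A i j *: (fun y : V m => y 0 i : C^o)).
    apply/funext => w; rewrite fct_sumE mxE; apply: eq_bigr => i _.
    by rewrite /= mulrC.
  by apply: differentiable_sum => i; apply: differentiableZ; case: (diff_coord y i).
have d (y : V m) : differentiable (fun y : V m => y *m A : V n) y.
  rewrite (_ : (fun y : V m => _) = (fun w => \row_j ((w *m A) 0 j) : V n)).
    by case: (differentiable_row (dj^~ y)).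
  by apply/funext => w; apply/rowP => j; rewrite [RHS]mxE.
split=> // v.
have fl : linear (fun y : V m => y *m A : V n).
  by move=> a u w; rewrite mulmxDl scalemxAl.
pose fL : {linear V m -> V n} := HB.pack (fun y : V m => y *m A : V n)
  (GRing.isLinear.Build _ _ _ _ _ fl).
rewrite (_ : (fun _ => _) = fL)// diff_lin// => y.
exact: differentiable_continuous (d y).
Qed.

Lemma diff_affine n (c : 'cV[C]_n) (k : C) (x : V n) :
  differentiable (fun y : V n => (y *m c) 0 0 + k : C^o) x /\
  forall v, 'd (fun y : V n => (y *m c) 0 0 + k : C^o) x v = (v *m c) 0 0.
Proof.
have [dm em] := diff_mulmx c x.
have [dc ec] := diff_coord (x *m c) 0.
have dl : differentiable ((fun y : V 1 => y 0 0 : C^o) \o (fun y : V n => y *m c : V 1)) x.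
  exact: (differentiable_comp dm dc).
have dk : differentiable (cst k : V n -> C^o) x by exact: differentiable_cst.
split; first exact: (differentiableD dl dk).
move=> v; apply: (etrans (congr1 (fun h : V n -> C^o => h v) (diffD dl dk))).
have E1 := congr1 (fun h : V n -> C^o => h v) (diff_comp dm dc).
have E2 := congr1 (fun h : V n -> C^o => h v) (diff_cst (k : C^o) x).
apply: (etrans (congr2 +%R E1 E2)).
apply: (etrans (addr0 _)).
by apply: (etrans (ec _)); exact: (congr1 (fun M : V 1 => M 0 0) (em v)).
Qed.

Lemma disc_tangent_rotate n (D : set (V n)) p v (nu : C) : cmod nu = 1 ->
  disc_tangent D p v -> disc_tangent D p (nu *: v).
Proof.
move=> nu1 [phi [phiD phi0 phi1]].
pose r : C^o -> C^o := fun z => nu *: z.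
have dr (z : C^o) : differentiable r z /\ 'd r z 1 = nu.
  have [? ->] := is_diff_scaler nu z; split=> //.
  by rewrite /GRing.scale/= mulr1.
have r0 : r 0 = 0 by rewrite /r scaler0.
exists (phi \o r); split.
- move=> z z1; have [|Dz dz] := phiD (r z).
    by rewrite /r /GRing.scale/= cmodM nu1 mul1r.
  have [drz _] := dr z.
  by split; [exact: Dz|exact: differentiable_comp drz dz].
- by rewrite /= r0.
- have [dr0 dr1] := dr 0; have c0 : cmod (0 : C) < 1 by rewrite cmod0.
  have [_ dphi] := phiD 0 c0.
  have dphi' : differentiable phi (r 0) by rewrite r0.
  rewrite (diff_comp dr0 dphi') /= dr1 r0 -phi1.
  by rewrite -linearZ/=; congr ('d _ _ _); rewrite /GRing.scale/= mulr1.
Qed.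

Lemma disc_tangent_row n (D : set (V n)) (F : 'I_n -> C^o -> C^o) :
  (forall z : C, cmod z < 1 ->
     D (\row_i F i z) /\ forall i, differentiable (F i) (z : C^o)) ->
  disc_tangent D (\row_i F i 0) (\row_i 'd (F i) (0 : C^o) 1).
Proof.
move=> FD; exists (fun z => \row_i F i z); split=> //.
- by move=> z /FD[Dz dz]; split=> //; case: (differentiable_row dz).
- have c0 : cmod (0 : C) < 1 by rewrite cmod0.
  by have [_ dz] := FD 0 c0; case: (differentiable_row dz).
Qed.

Lemma diff_lincomb (U : normedModType C) (f g : U -> C^o) (x : U) (a b : C) :
  differentiable f x -> differentiable g x ->
  differentiable (fun y => a * f y + b * g y : C^o) x /\
  forall w, 'd (fun y => a * f y + b * g y : C^o) x w = a * 'd f x w + b * 'd g x w.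
Proof.
move=> df dg.
have daf : differentiable (a *: f) x by exact: differentiableZ.
have dbg : differentiable (b *: g) x by exact: differentiableZ.
split; first exact: (differentiableD daf dbg).
move=> w; apply: (etrans (congr1 (fun h : U -> C^o => h w) (diffD daf dbg))).
have Ef := congr1 (fun h : U -> C^o => h w) (diffZ a df).
have Eg := congr1 (fun h : U -> C^o => h w) (diffZ b dg).
exact: (congr2 +%R Ef Eg).
Qed.

Lemma diff_quotient (U : normedModType C) (f g : U -> C^o) (x : U) :
  differentiable f x -> differentiable g x -> g x != 0 ->
  differentiable (fun y => f y / g y : C^o) x /\
  (g x = 1 -> forall w,
    'd (fun y => f y / g y : C^o) x w = 'd f x w - f x * 'd g x w).
Proof.
move=> df dg gx.
have dV : differentiable (fun y => (g y)^-1 : C^o) x by exact: differentiableV.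
split; first exact: (differentiableM df dV).
move=> g1 w.
apply: (etrans (congr1 (fun h : U -> C^o => h w) (diffM df dV))).
have EV := congr1 (fun h : U -> C^o => h w) (diffV dg gx).
apply: (etrans (congr1 (fun t : C => f x * t + (g x)^-1 * 'd f x w) EV)).
have alg (a b c d : C) : d = 1 -> a * (- (d ^- 2) * b) + d^-1 * c = c - a * b.
  by move=> ->; rewrite expr1n invr1; ring.
exact: alg g1.
Qed.

End Discs.

(** * Linear algebra: monomial involutions and generic real combinations *)

Section LinearAlgebra.
Variable R : realType.
Local Notation C := R[i].

(** As zeta runs through the unit circle, the point 1 + (zeta - 1) tau describes a
circle that passes through 1; it stays in the closed unit disc only if it is
tangent there, which means that tau is real. *)
Lemma real_of_rotations_le1 (tau : C) :
  (forall zeta : C, cmod zeta = 1 -> cmod (1 + (zeta - 1) * tau) <= 1) ->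
  complex.Im tau = 0.
Proof.
case: tau => a b /= H; apply/eqP; apply: contraT => b0.
have a0 : 0 < 1 + `|a| by rewrite ltr_pwDl.
pose s := (2 * (1 + `|a|))^-1.
have s0 : 0 < s by rewrite invr_gt0 mulr_gt0.
have sa : s * a <= 1 / 2.
  rewrite mulrC ler_pdivrMr ?mulr_gt0//; have := ler_norm a; lra.
pose t := - (s * b).
have t2 : 0 < 1 + t ^+ 2 by rewrite ltr_pwDl// sqr_ge0.
have t2' := lt0r_neq0 t2.
(* a point of the circle near 1, on the side where the modulus exceeds 1 *)
pose zeta : C := ((1 - t ^+ 2) / (1 + t ^+ 2)) +i* (2 * t / (1 + t ^+ 2)).
have z1 : cmod zeta = 1.
  rewrite cmodE/= (_ : _ + _ = 1) ?sqrtr1//.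
  by field.
have : cmod (1 + (zeta - 1) * (a +i* b)) ^+ 2 <= 1 by rewrite expr_le1 ?cmod_ge0// H.
rewrite sqr_cmod /= => K.
have E : (1 + t ^+ 2) * (t ^+ 2 * (a ^+ 2 + b ^+ 2) - t ^+ 2 * a - t * b) <= 0.
  move: K; rewrite -subr_le0 => K.
  have -> : (1 + t ^+ 2) * (t ^+ 2 * (a ^+ 2 + b ^+ 2) - t ^+ 2 * a - t * b)
    = (1 + t ^+ 2) ^+ 2 / 4 *
      ((1 + (((1 - t ^+ 2) / (1 + t ^+ 2) - 1) * a - (2 * t / (1 + t ^+ 2) - 0) * b)) ^+ 2 +
       (0 + (((1 - t ^+ 2) / (1 + t ^+ 2) - 1) * b + (2 * t / (1 + t ^+ 2) - 0) * a)) ^+ 2 - 1).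
    by field.
  by rewrite pmulr_rle0// divr_gt0// exprn_gt0.
move: E; rewrite pmulr_rle0// /t.
have -> : (- (s * b)) ^+ 2 * (a ^+ 2 + b ^+ 2) - (- (s * b)) ^+ 2 * a - - (s * b) * b
  = (s * b ^+ 2) * (s * (a ^+ 2 + b ^+ 2) - s * a + 1) by ring.
have b2 : 0 < b ^+ 2 by rewrite exprn_even_gt0.
rewrite pmulr_rle0 ?(mulr_gt0 s0 b2)//.
have : 0 <= s * (a ^+ 2 + b ^+ 2) by rewrite mulr_ge0 ?addr_ge0 ?sqr_ge0// ltW.
lra.
Qed.

(** The four coordinates are split into the pairs {0, 3} and {1, 2}, each of which
is exchanged by [rev_ord]; crossed indices belong to different pairs. *)
Definition cross (j k : 'I_4) := (k != j) && (k != rev_ord j).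

(** What the symmetry argument retains from the set of tangent vectors at the
origin of the hexablock.  Within a pair of coordinates the set contains the
distinguished boundary of a bidisc, while two crossed coordinates satisfy an
inequality under which the second vanishes once the first has modulus 1. *)
Record test_body (I : 'rV[C]_4 -> Prop) := TestBody {
  tb_torus : forall (d v : 'rV[C]_4), (forall i, cmod (d 0 i) = 1) -> I v ->
    I (\row_i (d 0 i * v 0 i));
  tb_diag : forall j : 'I_4, I (delta_mx 0 j + delta_mx 0 (rev_ord j));
  tb_le1 : forall v j, I v -> cmod (v 0 j) <= 1;
  tb_cross : forall v j k, I v -> cross j k -> cmod (v 0 j) = 1 -> v 0 k = 0
}.

Lemma rev4 (j : 'I_4) : rev_ord j != j.
Proof. by case: j => -[|[|[|[|]]]]. Qed.

(** Fix l, and let zeta be a complex number of modulus 1.  Multiplication of the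
coordinate l by zeta, conjugated by the involution G, is the complex reflection
  v |-> v + (zeta - 1) phi(v) u,   u = G e_l,   phi(v) = (G v)_l,
which preserves I.  It is applied to the vectors e_j + c e_j' of I with |c| = 1
and j' the partner of j.  The coordinate j of the result has modulus at most 1
for all zeta, whence phi(e_j') u_j = 0 by [real_of_rotations_le1].  Now pick j
with phi(e_j) <> 0.  Then u_j' = 0, the coordinate j' of the result is still c,
of modulus 1, and so the crossed coordinates of the result vanish.  This leaves
j as the only index at which u can be nonzero. *)
Lemma involutive_symmetry_monomial (I : 'rV[C]_4 -> Prop) (G : 'M[C]_4) :
    test_body I -> G *m G = 1%:M -> (forall v, I v -> I (v *m G)) ->
  forall l, exists k, forall j, j != k -> G l j = 0.
Proof.
case=> torus diag le1 cr GG GI l.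
pose u j := G l j; pose phi j := G j l.
have rot (zeta : C) v : cmod zeta = 1 -> I v ->
    I (v + ((zeta - 1) * \sum_j v 0 j * phi j) *: row l G).
  move=> z1 /GI Iv.
  (* the conjugate by G of the rotation of the coordinate l *)
  pose d : 'rV[C]_4 := \row_i (if i == l then zeta else 1).
  have := @torus d _ _ Iv; have d1 i : cmod (d 0 i) = 1.
    by rewrite mxE; case: ifP => _ //; rewrite cmod1.
  move=> /(_ d1)/GI; congr I.
  have -> : \row_i (d 0 i * (v *m G) 0 i) = v *m G + ((zeta - 1) * (v *m G) 0 l) *: delta_mx 0 l.
    apply/rowP => i; rewrite !mxE eqxx/=; case: (eqVneq i l) => [->|il]/=; last by ring.
    by ring.
  rewrite mulmxDl -mulmxA GG mulmx1 -scalemxAl -rowE.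
  by congr (_ + (_ * _) *: _); rewrite mxE.
have one : \sum_j u j * phi j = 1.
  by have /matrixP/(_ l l) := GG; rewrite !mxE eqxx.
have coord (zeta c : C) j m : cmod zeta = 1 -> cmod c = 1 ->
  exists v, [/\ I v,
    v 0 j = 1 + (zeta - 1) * (phi j + c * phi (rev_ord j)) * u j,
    v 0 (rev_ord j) = c + (zeta - 1) * (phi j + c * phi (rev_ord j)) * u (rev_ord j) &
    cross j m -> v 0 m = (zeta - 1) * (phi j + c * phi (rev_ord j)) * u m].
  move=> z1 c1.
  pose d : 'rV[C]_4 := \row_i (if i == rev_ord j then c else 1).
  have d1 i : cmod (d 0 i) = 1 by rewrite mxE; case: ifP => _ //; rewrite cmod1.
  have := rot zeta _ z1 (torus d _ d1 (diag j)); set w := \row_i _ => H.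
  have jr := negbTE (rev4 j).
  have wj : w 0 j = 1 by rewrite !mxE !eqxx/= eq_sym jr /= addr0 mulr1.
  have wr : w 0 (rev_ord j) = c by rewrite !mxE !eqxx/= jr /= add0r mulr1.
  have wm m' : cross j m' -> w 0 m' = 0.
    by move=> /andP[m1 m2]; rewrite !mxE !eqxx/= (negbTE m1) (negbTE m2) addr0 mulr0.
  have S : \sum_i w 0 i * phi i = phi j + c * phi (rev_ord j).
    rewrite (bigD1 j)//= (bigD1 (rev_ord j)) ?rev4//= wj wr mul1r big1 ?addr0// => i ij.
    by rewrite wm ?mul0r.
  rewrite S in H; eexists; split; first exact: H.
  - by rewrite mxE [X in _ + X]mxE [row l G 0 j]mxE wj.
  - by rewrite mxE [X in _ + X]mxE [row l G 0 _]mxE wr.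
  - by move=> /wm w0; rewrite mxE [X in _ + X]mxE [row l G 0 _]mxE w0 add0r.
have real_tau (c : C) j : cmod c = 1 ->
    complex.Im ((phi j + c * phi (rev_ord j)) * u j) = 0.
  move=> c1; apply: real_of_rotations_le1 => zeta z1.
  have [v [Iv vj _ _]] := coord zeta c j j z1 c1.
  by have := le1 v j Iv; rewrite vj mulrA.
have off j : phi (rev_ord j) * u j = 0.
  have c1 : cmod (1 : C) = 1 by rewrite cmod1.
  have cN1 : cmod (- 1 : C) = 1 by rewrite cmodN cmod1.
  have ci : cmod ('i%C : C) = 1 by rewrite cmodE/= expr0n expr1n add0r sqrtr1.
  have := real_tau _ j c1; have := real_tau _ j cN1; have := real_tau _ j ci.
  have -> (c : C) : (phi j + c * phi (rev_ord j)) * u j = phi j * u j + c * (phi (rev_ord j) * u j).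
    by ring.
  have -> (c : C) : (phi j + c * phi (rev_ord j)) * u j = phi j * u j + c * (phi (rev_ord j) * u j).
    by ring.
  have -> (c : C) : (phi j + c * phi (rev_ord j)) * u j = phi j * u j + c * (phi (rev_ord j) * u j).
    by ring.
  move: (phi (rev_ord j) * u j) (phi j * u j) => [x' y'] [x y] /= h1 h2 h3.
   by apply/eqP; rewrite eq_complex/=; apply/andP; split; apply/eqP; lra.
have [j phij] : exists j, phi j != 0.
  apply/existsP; apply: contraT; rewrite negb_exists => /forallP H.
  have := one; rewrite big1; first by move/eqP; rewrite eq_sym oner_eq0.
  by move=> j _; have := H j; rewrite negbK => /eqP->; rewrite mulr0.
have ur : u (rev_ord j) = 0.
  have := off (rev_ord j); rewrite rev_ordK => /eqP.
  by rewrite mulf_eq0 (negbTE phij)/= => /eqP.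
exists j => m mj; have [->//|mr] := eqVneq m (rev_ord j).
have jm : cross j m by rewrite /cross mj.
have rm : cross (rev_ord j) m by rewrite /cross rev_ordK mj mr.
have vanish (c : C) : cmod c = 1 -> (phi j + c * phi (rev_ord j)) * u m = 0.
  move=> c1; have zN1 : cmod (- 1 : C) = 1 by rewrite cmodN cmod1.
  have [v [Iv _ vr /(_ jm) vm]] := coord (-1) c j m zN1 c1.
  have := cr v _ _ Iv rm; rewrite vr ur mulr0 addr0 => /(_ c1).
  rewrite vm -mulrA => /eqP; rewrite mulf_eq0 => /orP[|/eqP//].
  by rewrite -opprD oppr_eq0 -[1 + 1]/(2%:R) pnatr_eq0.
have v1 := vanish 1 (cmod1 R).
have v2 : (phi j + -1 * phi (rev_ord j)) * u m = 0 by apply: vanish; rewrite cmodN cmod1.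
have : 2 * phi j * u m = 0.
  rewrite (_ : _ * u m = (phi j + 1 * phi (rev_ord j)) * u m
    + (phi j + -1 * phi (rev_ord j)) * u m); last by ring.
  by rewrite v1 v2 addr0.
by move/eqP; rewrite !mulf_eq0 pnatr_eq0 (negbTE phij)/= => /eqP.
Qed.

Lemma exists_nat_nonroot (P : {poly C}) : P != 0 -> exists n : nat, P.[n%:R] != 0.
Proof.
move=> P0; apply/not_existsP => H.
pose rs : seq C := [seq n%:R | n <- iota 0 (size P)].
suff : (size rs < size P)%N by rewrite size_map size_iota ltnn.
apply: max_poly_roots => //.
  apply/allP => _ /mapP[n _ ->]; rewrite rootE.
  by apply: contraT => /H.
by rewrite map_inj_uniq ?iota_uniq// => m n /eqP; rewrite eqr_nat => /eqP.
Qed.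

(** The coordinates of the combination with coefficients 1, t, t^2 are polynomials
in t.  For all but finitely many t the coordinates that vanish are those which
vanish identically; with at most two remaining coordinates, three vectors
cannot be independent. *)
Lemma real_combinations_not_sparse (N : 'M[C]_(3, 4)) :
    (forall t : 'rV[C]_3, t *m N = 0 -> t = 0) ->
    (forall t : 'rV[R]_3, t != 0 -> exists k l, forall j, j != k -> j != l ->
       (map_mx (real_complex R) t *m N) 0 j = 0) -> False.
Proof.
move=> inj two.
pose P j : {poly C} := \poly_(i < 3) N (inord i) j.
pose Q := \prod_(j < 4 | P j != 0) P j.
have Q0 : Q != 0 by rewrite prodf_seq_neq0; apply/allP => j _; exact/implyP.
have [n Qn] := exists_nat_nonroot Q0.
pose t : 'rV[R]_3 := \row_i n%:R ^+ i.
have t0 : t != 0.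
  by apply/negP => /eqP/rowP/(_ 0); rewrite !mxE expr0 => /eqP; rewrite oner_eq0.
have tN j : (map_mx (real_complex R) t *m N) 0 j = (P j).[n%:R].
  rewrite mxE horner_poly; apply: eq_bigr => i _.
  by rewrite !mxE inord_val mulrC rmorphXn/= rmorph_nat.
have [k [l kl]] := two t t0.
have col0 j : j != k -> j != l -> forall i, N i j = 0.
  move=> jk jl i; have := kl j jk jl; rewrite tN => /eqP Pn.
  have : P j == 0.
    apply: contraLR Qn => Pj; rewrite negbK horner_prod.
    by rewrite (bigD1 j)//= (eqP Pn) mul0r.
  move/eqP/polyP/(_ i); rewrite coef_poly ltn_ord coef0.
  by rewrite inord_val.
(* three vectors in a space of dimension two are dependent *)
pose N2 : 'M[C]_(3, 2) := \matrix_(i, j) N i (if j == 0 then k else l).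
have [t' t'0 t'N] : exists2 t' : 'rV[C]_3, t' != 0 & t' *m N2 = 0.
  have /rowV0Pn[t' t'K t'0] : kermx N2 != 0.
    rewrite -mxrank_eq0 mxrank_ker subn_eq0 -ltnNge ltnS.
    exact: rank_leq_col.
  by exists t' => //; apply/sub_kermxP.
move/negP: t'0; apply; apply/eqP; apply: inj; apply/rowP => j; rewrite mxE [RHS]mxE.
have [->|jk] := eqVneq j k.
  move/rowP/(_ 0): t'N; rewrite mxE [RHS]mxE => E; rewrite -[RHS]E.
  by apply: eq_bigr => i _; rewrite mxE.
have [->|jl] := eqVneq j l.
  move/rowP/(_ 1): t'N; rewrite mxE [RHS]mxE => E; rewrite -[RHS]E.
  by apply: eq_bigr => i _; rewrite mxE.
by rewrite big1// => i _; rewrite col0// mulr0.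
Qed.

End LinearAlgebra.

(** * The hexablock at the origin *)

Section Hexablock.
Variable R : realType.
Local Notation C := R[i].
Local Notation V n := ('rV[R[i]]_n : normedModType R[i]).
Local Notation H := (@hexablock R).
Implicit Types (v x : 'rV[C]_4) (z : C).

Definition i1 : 'I_4 := inord 1.
Definition i2 : 'I_4 := inord 2.
Definition i3 : 'I_4 := inord 3.

Definition denom v z1 z2 : C := 1 - v 0 i1 * z1 - v 0 i2 * z2 + v 0 i3 * z1 * z2.

(** The supremum in the definition of the hexablock is less than 1 exactly when the
quotients have a common bound c < 1; clearing denominators avoids the extended
reals. *)
Lemma hexablockP v : H v <->
  (forall z1 z2, cmod z1 <= 1 -> cmod z2 <= 1 -> denom v z1 z2 != 0) /\
  exists2 c : R, c < 1 & forall z1 z2, cmod z1 < 1 -> cmod z2 < 1 ->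
    cmod (v 0 0) * Num.sqrt ((1 - cmod z1 ^+ 2) * (1 - cmod z2 ^+ 2))
      <= c * cmod (denom v z1 z2).
Proof.
pose x : 'rV[C]_3 := rsubmx (v : 'rV[C]_(1 + 3)).
have vE (a : C) (y : 'rV[C]_3) : v = row_mx a%:M y -> a = v 0 0 /\ y = x.
  move=> vE; rewrite /x [in rsubmx _]vE row_mxKr; split=> //.
  have <- : (v : 'rV[C]_(1 + 3)) 0 (lshift 3 0) = a.
    by rewrite vE row_mxEl mxE eqxx mulr1n.
  by congr (v _ _); exact: val_inj.
have v0 : v = row_mx (v 0 0)%:M x.
  have -> : (v 0 0)%:M = lsubmx (v : 'rV[C]_(1 + 3)).
    by apply/rowP => i; rewrite !mxE ord1 eqxx mulr1n; congr (v _ _); exact: val_inj.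
  by rewrite hsubmxK.
have dE z1 z2 : tetra_denom x z1 z2 = denom v z1 z2.
  rewrite /tetra_denom /denom !mxE.
  have -> : rshift 1 (0 : 'I_3) = i1 by apply: val_inj; rewrite /= inordK.
  have -> : rshift 1 (1 : 'I_3) = i2 by apply: val_inj; rewrite /= inordK.
  by have -> : rshift 1 (2 : 'I_3) = i3 by apply: val_inj; rewrite /= inordK.
have qE z1 z2 : cmod (hexa_quotient (v 0 0) x z1 z2) = cmod (v 0 0) *
    Num.sqrt ((1 - cmod z1 ^+ 2) * (1 - cmod z2 ^+ 2)) / cmod (denom v z1 z2).
  by rewrite /hexa_quotient dE !cmodM cmodV cmod_real ger0_norm ?sqrtr_ge0.
split.
- move=> [a [y [/vE[-> ->] tx sup1]]]; split.
    by move=> z1 z2 h1 h2; rewrite -dE; exact: tx.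
  set S := ereal_sup _ in sup1.
  have S0 : (0 <= S)%E.
    apply: le_trans (ereal_sup_ubound _); last by exists 0; [|exists 0; [|reflexivity]];
       rewrite /unit_disc/= cmod0.
    by rewrite lee_fin cmod_ge0.
  have SE : S = (fine S)%:E by rewrite fineK// ge0_fin_numE// (lt_trans sup1) ?ltry.
  exists (fine S); first by rewrite -lte_fin -SE.
  move=> z1 z2 h1 h2.
  have d0 : 0 < cmod (denom v z1 z2) by rewrite cmod_gt0 -dE tx// ltW.
  rewrite -ler_pdivrMr// -qE -lee_fin -SE; apply: ereal_sup_ubound.
  by exists z1 => //; exists z2.
- move=> [tx [c c1 cP]]; exists (v 0 0), x; split=> //.
    by move=> z1 z2 h1 h2; rewrite dE; exact: tx.
  apply: (@le_lt_trans _ _ c%:E); last by rewrite lte_fin.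
  apply: ge_ereal_sup => _ [z1 h1 [z2 h2 <-]]; rewrite lee_fin qE.
  have d0 : 0 < cmod (denom v z1 z2) by rewrite cmod_gt0 tx// ltW.
  by rewrite ler_pdivrMr// cP.
Qed.

Lemma hexa_torus (d v : 'rV[C]_4) : (forall i, cmod (d 0 i) = 1) ->
  d 0 i3 = d 0 i1 * d 0 i2 -> H v -> H (v *m diag_mx d).
Proof.
move=> d1 d3 /hexablockP[tx [c c1 cP]].
have wE i : (v *m diag_mx d) 0 i = v 0 i * d 0 i.
  by rewrite mul_mx_diag mxE.
have dE z1 z2 : denom (v *m diag_mx d) z1 z2 = denom v (d 0 i1 * z1) (d 0 i2 * z2).
  by rewrite /denom !wE d3; ring.
apply/hexablockP; split.
  by move=> z1 z2 h1 h2; rewrite dE tx// cmodM d1 mul1r.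
exists c => // z1 z2 h1 h2; rewrite dE wE.
have := cP (d 0 i1 * z1) (d 0 i2 * z2).
by rewrite !cmodM !d1 !mul1r mulr1; apply.
Qed.

(** For z_1 = conj x_1 and z_2 = 0 the defining inequality of the hexablock reads
|a| sqrt(1 - |x_1|^2) < 1 - |x_1|^2, and similarly for x_2. *)
Lemma hexa_ball1 v j : H v -> j = i1 \/ j = i2 ->
  cmod (v 0 0) ^+ 2 + cmod (v 0 j) ^+ 2 <= 1.
Proof.
move=> /hexablockP[tx [c c1 cP]] jP.
have c01 : cmod (0 : C) <= 1 by rewrite cmod0.
have tj z : cmod z <= 1 -> 1 - v 0 j * z != 0.
  move=> z1; case: jP => ->.
    by have := tx z 0 z1 c01; rewrite /denom !mulr0 subr0 addr0.
  by have := tx 0 z c01 z1; rewrite /denom !(mulr0, mul0r) subr0 addr0.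
have vj1 : cmod (v 0 j) < 1.
  rewrite ltNge; apply/negP => vj; have vj0 : v 0 j != 0.
    by rewrite -cmod_gt0 (lt_le_trans ltr01).
  have /tj : cmod (v 0 j)^-1 <= 1 by rewrite cmodV invf_le1// (lt_le_trans ltr01).
  by rewrite divff// subrr eqxx.
set r := cmod (v 0 j) in vj1 *; have r0 : 0 <= r by exact: cmod_ge0.
have r2 : 0 < 1 - r ^+ 2 by rewrite subr_gt0 expr_lt1.
have K : cmod (v 0 0) * Num.sqrt (1 - r ^+ 2) <= c * (1 - r ^+ 2).
  have E : cmod (1 - v 0 j * (v 0 j)^*) = 1 - r ^+ 2.
    by rewrite mulc_conj -(rmorph1 (real_complex R)) -rmorphB cmod_real ger0_norm// ltW.
  have j1 : cmod (v 0 j)^* < 1 by rewrite cmod_conj.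
  have c0 : cmod (0 : C) < 1 by rewrite cmod0.
  case: jP E j1 => jE E j1.
    have := cP _ _ j1 c0; rewrite /denom !mulr0 subr0 addr0 -jE E.
    by rewrite cmod0 expr0n subr0 mulr1 cmod_conj.
  have := cP _ _ c0 j1; rewrite /denom !(mulr0, mul0r) subr0 addr0 -jE E.
  by rewrite cmod0 expr0n subr0 mul1r cmod_conj.
have s0 : 0 < Num.sqrt (1 - r ^+ 2) by rewrite sqrtr_gt0.
have : cmod (v 0 0) <= Num.sqrt (1 - r ^+ 2).
  rewrite -(ler_pM2r s0); apply: le_trans K _.
  rewrite -expr2 (sqr_sqrtr (ltW r2)) ler_piMl// ltW//.
rewrite -(ler_pXn2r (n := 2))// ?nnegrE ?cmod_ge0 ?sqrtr_ge0//.
by rewrite (sqr_sqrtr (ltW r2)) => ?; lra.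
Qed.

(** The rational function (x_j - zeta x_3)/(1 - zeta x_k) is bounded by 1 on the
tetrablock: otherwise z = (1 - zeta x_k)/(x_j - zeta x_3) would be a point of
the closed disc at which the polynomial defining the tetrablock vanishes. *)
Lemma tetra_schur v (j k : 'I_4) zeta : H v -> (j, k) = (i1, i2) \/ (j, k) = (i2, i1) ->
  cmod zeta = 1 ->
  1 - zeta * v 0 k != 0 /\ cmod (v 0 j - zeta * v 0 i3) <= cmod (1 - zeta * v 0 k).
Proof.
move=> /hexablockP[tx _] jk z1.
have t z : cmod z <= 1 -> 1 - zeta * v 0 k - z * (v 0 j - zeta * v 0 i3) != 0.
  move=> hz; have z1' : cmod zeta <= 1 by rewrite z1.
  case: jk => -[-> ->].
    by have := tx _ _ hz z1'; apply: contra => /eqP <-; apply/eqP; rewrite /denom; ring.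
  by have := tx _ _ z1' hz; apply: contra => /eqP <-; apply/eqP; rewrite /denom; ring.
split; first by have := t 0; rewrite cmod0 mul0r subr0; apply.
rewrite leNgt; apply/negP => lt.
have n0 : v 0 j - zeta * v 0 i3 != 0 by rewrite -cmod_gt0 (le_lt_trans _ lt)// cmod_ge0.
have := t ((1 - zeta * v 0 k) / (v 0 j - zeta * v 0 i3)).
rewrite divfK// subrr eqxx; have -> // : cmod ((1 - zeta * v 0 k) / (v 0 j - zeta * v 0 i3)) <= 1.
  by rewrite cmodM cmodV ler_pdivrMr ?cmod_gt0// mul1r ltW.
by move=> /(_ isT).
Qed.

(** The Schwarz lemma for the linear form given by the scalar product with
(v_0, v_j), which is bounded on the hexablock by [hexa_ball1]. *)
Lemma hexa_tangent_ball v (j : 'I_4) : disc_tangent (H : set (V 4)) 0 v ->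
  j = i1 \/ j = i2 -> cmod (v 0 0) ^+ 2 + cmod (v 0 j) ^+ 2 <= 1.
Proof.
move=> Iv jP.
set p := cmod (v 0 0); set q := cmod (v 0 j).
have pq0 : 0 <= p ^+ 2 + q ^+ 2 by rewrite addr_ge0 ?sqr_ge0.
have [E|N0] := eqVneq (p ^+ 2 + q ^+ 2) 0; first by rewrite E ler01.
pose N := Num.sqrt (p ^+ 2 + q ^+ 2).
have NN : N ^+ 2 = p ^+ 2 + q ^+ 2 by rewrite sqr_sqrtr.
have Np : 0 < N by rewrite sqrtr_gt0 lt_neqAle eq_sym N0.
pose c0 : C := (v 0 0)^* / N%:C; pose cj : C := (v 0 j)^* / N%:C.
pose g : V 4 -> C^o := fun x => c0 * x 0 0 + cj * x 0 j.
have dg (x : V 4) : differentiable g x /\ forall w, 'd g x w = c0 * w 0 0 + cj * w 0 j.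
  have [d0 e0] := diff_coord x 0; have [dj ej] := diff_coord x j.
  have [dg eg] := diff_lincomb c0 cj d0 dj.
  split; first exact: dg.
  by move=> w; apply: (etrans (eg w)); exact: (congr2 (fun a b : C => c0 * a + cj * b) (e0 w) (ej w)).
have gv : 'd g (0 : V 4) v = N%:C.
  apply: (etrans ((dg 0).2 v)); rewrite /c0 /cj mulrAC (mulrC _ (v 0 0)) mulc_conj.
  rewrite mulrAC (mulrC _ (v 0 j)) mulc_conj -/p -/q -mulrDl -rmorphD/= -NN.
  by rewrite -fmorphV -rmorphM; congr _%:C; rewrite expr2 mulfK ?gt_eqF.
suff : cmod ('d g (0 : V 4) v) <= 1.
  by rewrite gv cmod_real gtr0_norm// => N1; rewrite -NN expr_le1// ltW.
  apply: (@disc_tangent_schwarz R 4 H g 0 v); last exact: Iv.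
    move=> x Hx; split; first exact: (dg x).1.
    have B := hexa_ball1 Hx jP.
    rewrite /g; apply: le_trans (cmodD _ _) _; rewrite !cmodM !cmodV !cmod_conj cmod_real gtr0_norm//.
    rewrite -/p -/q; move: B; set s := cmod (x 0 0); set t := cmod (x 0 j) => B.
    rewrite -[p / N * s]mulrAC -[q / N * t]mulrAC -mulrDl ler_pdivrMr// mul1r.
    have st0 : 0 <= p * s + q * t by rewrite addr_ge0// mulr_ge0// cmod_ge0.
    rewrite -(ler_pXn2r (n := 2))// ?nnegrE ?(ltW Np)// NN.
    have -> : (p * s + q * t) ^+ 2 = (p ^+ 2 + q ^+ 2) * (s ^+ 2 + t ^+ 2) - (p * t - q * s) ^+ 2.
      by ring.
    rewrite lerBlDr; apply: (@le_trans _ _ (p ^+ 2 + q ^+ 2)).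
      by rewrite ler_piMr.
    by rewrite lerDl sqr_ge0.
by rewrite /g !mxE !mulr0 addr0.
Qed.

(** The derivative at 0 of the function of [tetra_schur] is v_j - zeta v_3; zeta
is chosen such that the two terms have the same argument. *)
Lemma hexa_tangent_tetra v (j k : 'I_4) : disc_tangent (H : set (V 4)) 0 v ->
  (j, k) = (i1, i2) \/ (j, k) = (i2, i1) -> cmod (v 0 j) + cmod (v 0 i3) <= 1.
Proof.
move=> Iv jk.
have main zeta : cmod zeta = 1 -> cmod (v 0 j - zeta * v 0 i3) <= 1.
  move=> z1.
  pose n : V 4 -> C^o := fun x => 1 * x 0 j + (- zeta) * x 0 i3.
  pose d : V 4 -> C^o := fun x => 1 * 1 + (- zeta) * x 0 k.
  have nE x : n x = x 0 j - zeta * x 0 i3 by rewrite /n mul1r mulNr.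
  have dE x : d x = 1 - zeta * x 0 k by rewrite /d mul1r mulNr.
  have dn (x : V 4) : differentiable n x /\
      forall w, 'd n x w = 1 * w 0 j + (- zeta) * w 0 i3.
    have [dj ej] := diff_coord x j; have [d3 e3] := diff_coord x i3.
    have [dg eg] := diff_lincomb 1 (- zeta) dj d3.
    split; first exact: dg.
    by move=> w; apply: (etrans (eg w)); exact: (congr2 (fun a b : C => 1 * a + (- zeta) * b) (ej w) (e3 w)).
  have dd (x : V 4) : differentiable d x.
    have [dk _] := diff_coord x k.
    exact: (diff_lincomb 1 (- zeta) (differentiable_cst (1 : C^o) x) dk).1.
  have n0 : n 0 = 0 by rewrite nE !mxE mulr0 subr0.
  have d0 : d 0 = 1 by rewrite dE !mxE mulr0 subr0.
  pose g : V 4 -> C^o := fun x => n x / d x.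
  have gv : 'd g (0 : V 4) v = v 0 j - zeta * v 0 i3.
    have d00 : d 0 != 0 by rewrite d0 oner_eq0.
    have [_ E] := diff_quotient (dn 0).1 (dd 0) d00.
    apply: (etrans (E d0 v)).
    apply: (etrans (congr1 (fun t : C => t - n 0 * 'd d (0 : V 4) v) ((dn 0).2 v))).
    rewrite n0 [X in _ - X](_ : _ = 0); last exact: mul0r.
    by rewrite subr0 mul1r mulNr.
  rewrite -gv; apply: (@disc_tangent_schwarz R 4 H g 0 v); last exact: Iv.
    move=> x Hx; have [dx nx] := tetra_schur Hx jk z1.
    have dx0 : d x != 0 by rewrite dE.
    split; first exact: (diff_quotient (dn x).1 (dd x) dx0).1.
    by rewrite /g cmodM cmodV ler_pdivrMr ?cmod_gt0// mul1r nE dE.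
  by rewrite /g n0 mul0r.
have [v30|v30] := eqVneq (v 0 i3) 0.
  by have := main 1 (cmod1 R); rewrite v30 mulr0 subr0 cmod0 addr0.
have [vj0|vj0] := eqVneq (v 0 j) 0.
  by have := main 1 (cmod1 R); rewrite vj0 mul1r sub0r cmodN cmod0 add0r.
have m3 : cmod (v 0 i3) != 0 by rewrite cmod_eq0.
have mj : cmod (v 0 j) != 0 by rewrite cmod_eq0.
pose zeta : C := - (v 0 j / (cmod (v 0 j))%:C) * ((cmod (v 0 i3))%:C / v 0 i3).
have z1 : cmod zeta = 1.
  rewrite /zeta cmodM cmodN !cmodM !cmodV !cmod_real !ger0_norm ?cmod_ge0//.
  by rewrite divff// divff// mulr1.
have := main _ z1.
have -> : v 0 j - zeta * v 0 i3 = (1 + (cmod (v 0 i3) / cmod (v 0 j)))%:C * v 0 j.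
  have cj0 : (cmod (v 0 j))%:C != 0 by rewrite -(rmorph0 (real_complex R)) (inj_eq (@complexI R)).
  have alg (a b x y : C) : a != 0 -> y != 0 ->
    x - - (x / a) * (b / y) * y = (1 + b / a) * x by move=> *; field; apply/andP.
  by rewrite rmorphD rmorphM rmorph1/= fmorphV /zeta alg.
rewrite cmodM cmod_real ger0_norm ?addr_ge0 ?divr_ge0 ?cmod_ge0//.
by rewrite mulrDl mul1r divfK.
Qed.

Lemma I4P (j : 'I_4) : [\/ j = 0, j = i1, j = i2 | j = i3].
Proof.
case: j => -[|[|[|[|//]]]] jP; [apply: Or41|apply: Or42|apply: Or43|apply: Or44];
  by apply: val_inj; rewrite /= ?inordK.
Qed.

Lemma rev_i4 : [/\ rev_ord (0 : 'I_4) = i3, rev_ord i1 = i2, rev_ord i2 = i1 & rev_ord i3 = 0].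
Proof. by split; apply: val_inj; rewrite /= !inordK. Qed.

Lemma i4_neq : [/\ (i1 == 0) = false, (i2 == 0) = false, (i3 == 0) = false &
  [/\ (i1 == i2) = false, (i1 == i3) = false & (i2 == i3) = false]].
Proof. by rewrite -!val_eqE/= !inordK. Qed.

Lemma disc_square (z : C^o) :
  differentiable (fun w : C^o => w * w : C^o) z /\
  'd (fun w : C^o => w * w : C^o) z 1 = z + z.
Proof.
pose f : C^o -> C^o := fun w => w.
have [df ef] : is_diff z f f := is_diff_id z.
split; first exact: (differentiableM df df).
apply: (etrans (congr1 (fun h : C^o -> C^o => h 1) (diffM df df))).
rewrite ef -[LHS]/(z * 1 + z * 1) mulr1; reflexivity.
Qed.

(** The disc z |-> (z, 0, 0, z). *)
Lemma hexa_tangent_03 : disc_tangent (H : set (V 4)) 0 (delta_mx 0 0 + delta_mx 0 i3).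
Proof.
have [n10 n20 n30 [n12 n13 n23]] := i4_neq.
pose F (i : 'I_4) (z : C^o) : C^o := ((i == 0) || (i == i3))%:R *: z.
have dF i (z : C^o) : differentiable (F i) z /\ 'd (F i) z 1 = ((i == 0) || (i == i3))%:R.
  have [d e] := is_diff_scaler ((i == 0) || (i == i3))%:R z; split; first exact: d.
  apply: (etrans (congr1 (fun h : C^o -> C^o => h 1) e)).
  by rewrite -[LHS]/(_ * 1) mulr1.
have := @disc_tangent_row R 4 H F.
have -> : \row_i F i 0 = 0 by apply/rowP => i; rewrite !mxE /F scaler0.
have -> : \row_i 'd (F i) (0 : C^o) 1 = delta_mx 0 0 + delta_mx 0 i3.
  apply/rowP => i; rewrite !mxE eqxx/=.
  rewrite (dF i 0).2.
  by case: (I4P i) => ->; rewrite ?n10 ?n20 ?n30 ?n13 ?n23 ?eqxx ?addr0 ?add0r// eq_sym n30 addr0.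
apply => z z1; split; last by move=> i; exact: (dF i z).1.
have FE i : (\row_i F i z) 0 i = ((i == 0) || (i == i3))%:R * z by rewrite mxE.
have dE t1 t2 : denom (\row_i F i z) t1 t2 = 1 + z * (t1 * t2).
  by rewrite /denom !FE n10 n20 n13 n23 eqxx orbT/=; ring.
have low (w : C) : 1 - cmod w <= cmod (1 + w).
  rewrite lerBlDr -(cmod1 R) -{1}[1](addrK w) -[in leRHS](cmodN w); exact: cmodD.
apply/hexablockP; split.
  move=> t1 t2 h1 h2; rewrite dE -cmod_gt0; apply: lt_le_trans (low _).
  rewrite subr_gt0 !cmodM; apply: le_lt_trans z1.
  by rewrite ler_piMr ?cmod_ge0// mulr_ile1 ?cmod_ge0.
exists (cmod z) => // t1 t2 h1 h2; rewrite dE FE eqxx mul1r.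
rewrite ler_wpM2l ?cmod_ge0//; apply: le_trans (low _); rewrite !cmodM.
move: h1 h2 (cmod_ge0 t1) (cmod_ge0 t2) (cmod_ge0 z) z1.
move: (cmod t1) (cmod t2) (cmod z) => r s c r1 s1 r0 s0 c0 c1.
have rs0 : 0 <= r * s by rewrite mulr_ge0.
have rs1 : r * s <= 1 by rewrite mulr_ile1// ltW.
apply: (@le_trans _ _ (1 - r * s)); last by rewrite lerD2l lerN2 ler_piMl// ltW.
rewrite -[leRHS]ger0_norm ?subr_ge0// -sqrtr_sqr ler_wsqrtr//.
rewrite -subr_ge0 (_ : _ - _ = (r - s) ^+ 2) ?sqr_ge0//; ring.
Qed.

(** The disc z |-> (0, z, z, z^2), for which the polynomial defining the tetrablock
is the product (1 - z z_1)(1 - z z_2). *)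
Lemma hexa_tangent_12 : disc_tangent (H : set (V 4)) 0 (delta_mx 0 i1 + delta_mx 0 i2).
Proof.
have [n10 n20 n30 [n12 n13 n23]] := i4_neq.
pose k (i : 'I_4) : C := ((i == i1) || (i == i2))%:R.
pose F (i : 'I_4) (z : C^o) : C^o := if i == i3 then z * z else k i *: z.
have dF i (z : C^o) : differentiable (F i) z /\ 'd (F i) z 1 = if i == i3 then z + z else k i.
  rewrite /F; case: ifP => _; first exact: disc_square.
  have [d e] := is_diff_scaler (k i) z; split; first exact: d.
  apply: (etrans (congr1 (fun h : C^o -> C^o => h 1) e)).
  by rewrite -[LHS]/(k i * 1) mulr1.
have := @disc_tangent_row R 4 H F.
have -> : \row_i F i 0 = 0.
  by apply/rowP => i; rewrite !mxE /F; case: ifP => _; rewrite ?mulr0 ?scaler0.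
have -> : \row_i 'd (F i) (0 : C^o) 1 = delta_mx 0 i1 + delta_mx 0 i2.
  apply/rowP => i; rewrite !mxE eqxx/=.
  rewrite (dF i 0).2 /k.
  case: (I4P i) => ->; rewrite ?n10 ?n20 ?n30 ?n13 ?n23 ?n12 ?eqxx /=.
  - by rewrite ![0 == _]eq_sym n10 n20 n30 addr0.
  - by rewrite addr0.
  - by rewrite [i2 == _]eq_sym n12 add0r.
  - by rewrite ![i3 == _]eq_sym n13 n23 !addr0.
apply => z z1; split; last by move=> i; exact: (dF i z).1.
have F0 : (\row_i F i z) 0 0 = 0.
  by rewrite mxE /F /k ![0 == _]eq_sym n30 n10 n20 scale0r.
have F1 : (\row_i F i z) 0 i1 = z by rewrite mxE /F /k n13 eqxx scale1r.
have F2 : (\row_i F i z) 0 i2 = z by rewrite mxE /F /k n23 eqxx orbT scale1r.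
have F3 : (\row_i F i z) 0 i3 = z * z by rewrite mxE /F eqxx.
have dE t1 t2 : denom (\row_i F i z) t1 t2 = (1 - z * t1) * (1 - z * t2).
  by rewrite /denom F1 F2 F3; ring.
have nz (t : C) : cmod t <= 1 -> 1 - z * t != 0.
  move=> t1; rewrite subr_eq0; apply/eqP => /(congr1 (@cmod R)).
  rewrite cmod1 cmodM => E; have : cmod z * cmod t < 1; last by rewrite -E ltxx.
  by apply: le_lt_trans z1; rewrite ler_piMr ?cmod_ge0.
apply/hexablockP; split.
  by move=> t1 t2 h1 h2; rewrite dE mulf_neq0 ?nz.
exists 0 => // t1 t2 h1 h2.
by rewrite F0 cmod0 !mul0r.
Qed.

(** A diagonal unitary matrix d is, up to the factor nu = d_1 d_2 / d_3, the
restriction of an automorphism of the hexablock, and nu is absorbed by a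
rotation of the disc. *)
Lemma hexa_test_body : test_body (disc_tangent (H : set (V 4)) 0).
Proof.
have [r0 r1 r2 r3] := rev_i4; have [n10 n20 n30 [n12 n13 n23]] := i4_neq.
split.
- move=> d v d1 Iv.
  have d0 i : d 0 i != 0 by rewrite -cmod_gt0 d1.
  pose nu := d 0 i1 * d 0 i2 / d 0 i3.
  pose e : 'rV[C]_4 := \row_i (d 0 i / nu).
  have nu1 : cmod nu = 1 by rewrite !cmodM cmodV !d1 invr1 !mulr1.
  have nu0 : nu != 0 by rewrite -cmod_gt0 nu1.
  have e1 i : cmod (e 0 i) = 1 by rewrite mxE cmodM cmodV d1 nu1 invr1 mulr1.
  have e3 : e 0 i3 = e 0 i1 * e 0 i2.
    by rewrite !mxE /nu; field; rewrite !d0.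
  have [dT eT] := @diff_mulmx R 4 4 (diag_mx e) 0.
  have := @disc_tangent_push R 4 4 H H (fun y : V 4 => y *m diag_mx e : V 4) 0 (nu *: v).
  rewrite (eT (nu *: v)) mul0mx.
  have -> : nu *: v *m diag_mx e = \row_i (d 0 i * v 0 i).
    by apply/rowP => i; rewrite mul_mx_diag !mxE; field.
  apply.
  + by move=> x _; exact: (diff_mulmx _ _).1.
  + by move=> x; exact: hexa_torus.
  + exact: disc_tangent_rotate.
- move=> j; case: (I4P j) => ->; rewrite ?r0 ?r1 ?r2 ?r3.
  + exact: hexa_tangent_03.
  + exact: hexa_tangent_12.
  + by rewrite addrC; exact: hexa_tangent_12.
  + by rewrite addrC; exact: hexa_tangent_03.
- move=> v j Iv.
  have B1 := hexa_tangent_ball Iv (or_introl erefl).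
  have B2 := hexa_tangent_ball Iv (or_intror erefl).
  have T1 := hexa_tangent_tetra Iv (or_introl erefl).
  have c0 i := cmod_ge0 (v 0 i).
  have sq (a b : R) : 0 <= a -> a ^+ 2 + b ^+ 2 <= 1 -> a <= 1.
    by move=> a0 ab; rewrite -(expr_le1 (n := 2))//; have := sqr_ge0 b; lra.
  case: (I4P j) => ->.
  + exact: sq B1.
  + by rewrite addrC in B1; exact: sq B1.
  + by rewrite addrC in B2; exact: sq B2.
  + by have := c0 i1; lra.
- move=> v j k Iv /andP[kj kr] vj.
  have B1 := hexa_tangent_ball Iv (or_introl erefl).
  have B2 := hexa_tangent_ball Iv (or_intror erefl).
  have T1 := hexa_tangent_tetra Iv (or_introl erefl).
  have T2 := hexa_tangent_tetra Iv (or_intror erefl).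
  have c0 i := cmod_ge0 (v 0 i).
  have sq (a b : R) : a = 1 -> a ^+ 2 + b ^+ 2 <= 1 -> b = 0.
    by move=> ->; rewrite expr1n gerDl => b0; apply/eqP; rewrite -sqrf_eq0 eq_le b0 sqr_ge0.
  apply/eqP; rewrite -cmod_eq0; apply/eqP.
  case: (I4P j) (I4P k) kj kr vj => -> [] -> ; rewrite ?r0 ?r1 ?r2 ?r3 ?eqxx// => _ _ vj.
  + exact: sq B1.
  + exact: sq B2.
  + by rewrite addrC in B1; exact: sq B1.
  + by move: T1; rewrite vj gerDl => b0; apply/eqP; rewrite eq_le b0 c0.
  + by rewrite addrC in B2; exact: sq B2.
  + by move: T2; rewrite vj gerDl => b0; apply/eqP; rewrite eq_le b0 c0.
  + by move: T1; rewrite vj gerDr => b0; apply/eqP; rewrite eq_le b0 c0.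
  + by move: T2; rewrite vj gerDr => b0; apply/eqP; rewrite eq_le b0 c0.
Qed.

End Hexablock.

(** * The Lie ball modulo a reflection, and its projective reflections *)

Section LieBallQuotient.
Variable R : realType.
Local Notation C := R[i].

(** With q = z_1^2 + z_2^2 + z_3^2 + w^2 this says that (z_1, z_2, z_3, w) belongs to
the Lie ball, and it does not depend on the sign of w. *)
Definition in_lie_quotient (z1 z2 z3 q : C) : Prop := cmod q < 1 /\
  cmod z1 ^+ 2 + cmod z2 ^+ 2 + cmod z3 ^+ 2 + cmod (q - (z1 ^+ 2 + z2 ^+ 2 + z3 ^+ 2))
    < (1 + cmod q ^+ 2) / 2.

Lemma in_lie_quotient_homogeneous (z1 z2 z3 k t : C) : cmod k < cmod t ->
  cmod z1 ^+ 2 + cmod z2 ^+ 2 + cmod z3 ^+ 2 + cmod (k * t - (z1 ^+ 2 + z2 ^+ 2 + z3 ^+ 2))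
    < (cmod t ^+ 2 + cmod k ^+ 2) / 2 ->
  in_lie_quotient (z1 / t) (z2 / t) (z3 / t) (k / t).
Proof.
move=> kt H.
have t0 : 0 < cmod t by apply: le_lt_trans kt; exact: cmod_ge0.
have tn0 : t != 0 by rewrite -cmod_gt0.
split; first by rewrite cmodM cmodV ltr_pdivrMr// mul1r.
have -> : k / t - ((z1 / t) ^+ 2 + (z2 / t) ^+ 2 + (z3 / t) ^+ 2)
  = (k * t - (z1 ^+ 2 + z2 ^+ 2 + z3 ^+ 2)) / t ^+ 2 by field.
rewrite !cmodM !cmodV cmodX !exprMn !exprVn -!mulrDl ltr_pdivrMr ?exprn_gt0//.
by apply: lt_le_trans H _; rewrite le_eqVlt; apply/orP; left; apply/eqP; field; rewrite gt_eqF.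
Qed.

Lemma Re_vector_identity (z1 z2 z3 q c : C) :
  cmod ((c^* + c * q) / 2) ^+ 2 - (complex.Re (c * z1) ^+ 2 +
     complex.Re (c * z2) ^+ 2 + complex.Re (c * z3) ^+ 2)
  = (cmod c ^+ 2 * ((1 + cmod q ^+ 2) / 2 - (cmod z1 ^+ 2 + cmod z2 ^+ 2 + cmod z3 ^+ 2))
    + complex.Re (c ^+ 2 * (q - (z1 ^+ 2 + z2 ^+ 2 + z3 ^+ 2)))) / 2.
Proof.
have -> : cmod ((c^* + c * q) / 2) ^+ 2 = cmod (c^* + c * q) ^+ 2 / 4.
  have c2 : cmod (2 : C) = 2 by rewrite -(rmorph_nat (real_complex R) 2) cmod_real ger0_norm.
  rewrite cmodM cmodV c2 exprMn exprVn.
  by congr (_ / _); ring.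
rewrite !sqr_cmod !expr2.
by case: z1 z2 z3 q c => [? ?] [? ?] [? ?] [? ?] [? ?] /=; field.
Qed.

(** The real vector Re (c (z, 1, q)) of R^(3,2) has components Re (c z_j), of
positive sign, and (conj c + c q)/2, of negative sign; the inequality expresses
that the real plane attached to a point of the domain is negative definite. *)
Lemma Re_vector_bound (z1 z2 z3 q c : C) : in_lie_quotient z1 z2 z3 q ->
  complex.Re (c * z1) ^+ 2 + complex.Re (c * z2) ^+ 2 + complex.Re (c * z3) ^+ 2
    <= cmod ((c^* + c * q) / 2) ^+ 2 ?= iff (c == 0).
Proof.
move=> [_ H].
have I := Re_vector_identity z1 z2 z3 q c.
set w := q - _ in H I.
have := Re_le_cmod (c ^+ 2 * w); rewrite cmodM cmodX ler_norml => /andP[K _].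
set S := cmod z1 ^+ 2 + cmod z2 ^+ 2 + cmod z3 ^+ 2 in H I.
have P : cmod c ^+ 2 * (((1 + cmod q ^+ 2) / 2) - (S + cmod w)) / 2 <=
  cmod ((c^* + c * q) / 2) ^+ 2 - (complex.Re (c * z1) ^+ 2 +
     complex.Re (c * z2) ^+ 2 + complex.Re (c * z3) ^+ 2).
  rewrite I ler_pM2r ?invr_gt0// opprD addrA mulrDr mulrN; lra.
have H' : 0 < (1 + cmod q ^+ 2) / 2 - (S + cmod w) by rewrite subr_gt0.
have [->|c0] := eqVneq c 0.
  split; last by rewrite !mul0r rmorph0 addr0 mul0r cmod0 expr0n/= !addr0 eqxx.
  by rewrite !mul0r /= expr0n !addr0 sqr_ge0.
have P0 : 0 < cmod c ^+ 2 * (((1 + cmod q ^+ 2) / 2) - (S + cmod w)) / 2.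
  by rewrite divr_gt0// mulr_gt0// exprn_gt0// cmod_gt0.
have := lt_le_trans P0 P; rewrite subr_gt0 => lt.
by split; [exact: ltW|rewrite lt_eqF].
Qed.

(** A real vector of R^(3,2) is a pair of v in R^3 and eta in C.  This is the
only eta for which (v, eta) is orthogonal to the point (z, 1, q). *)
Definition fixing_eta (v1 v2 v3 : R) (z1 z2 z3 q : C) : C :=
  let w := v1%:C * z1 + v2%:C * z2 + v3%:C * z3 in
  2 * (w - q * w^* ) / (1 - cmod q ^+ 2)%:C.

Lemma conjM (a b : C) : (a * b)^* = a^* * b^*.
Proof. exact: rmorphM. Qed.

Lemma conj_frac (a b : C) (w : R) : (2 * (a - b) / w%:C)^* = 2 * (a^* - b^* ) / w%:C.
Proof.
case: a b => [? ?] [? ?]; apply/eqP; rewrite eq_complex /=.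
by apply/andP; split; apply/eqP; ring.
Qed.

Lemma eta_parametrization (q h : C) : cmod q < 1 ->
  exists c, h = (c^* + c * q) / 2.
Proof.
move=> q1; have W0 : 0 < 1 - cmod q ^+ 2 by rewrite subr_gt0 expr_lt1 ?cmod_ge0.
exists (2 * (h^* - q^* * h) / (1 - cmod q ^+ 2)%:C).
have W0' : (1 - cmod q ^+ 2)%:C != 0 by rewrite -(rmorph0 (real_complex R)) (inj_eq (@complexI R)) gt_eqF.
rewrite conj_frac conjM !conjCK.
have E : (1 - cmod q ^+ 2)%:C = 1 - q * q^* by rewrite mulc_conj rmorphB rmorph1.
by rewrite E in W0' *; field.
Qed.

Lemma fixing_etaE v1 v2 v3 z1 z2 z3 q : cmod q < 1 ->
  let w := v1%:C * z1 + v2%:C * z2 + v3%:C * z3 in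
  let h := fixing_eta v1 v2 v3 z1 z2 z3 q in
  w = (h + q * h^* ) / 2.
Proof.
move=> q1 w h; have W0 : 0 < 1 - cmod q ^+ 2 by rewrite subr_gt0 expr_lt1 ?cmod_ge0.
have W0' : (1 - cmod q ^+ 2)%:C != 0 by rewrite -(rmorph0 (real_complex R)) (inj_eq (@complexI R)) gt_eqF.
rewrite /h /fixing_eta -/w.
rewrite conj_frac conjM !conjCK.
have E : (1 - cmod q ^+ 2)%:C = 1 - q * q^* by rewrite mulc_conj rmorphB rmorph1.
by rewrite E in W0' *; field.
Qed.

(** The orthogonal complement of a negative plane is positive.  The proof is the
reversed Cauchy-Schwarz inequality for (v, eta) and the vector of that plane
whose negative component is eta. *)
Lemma fixing_eta_lt v1 v2 v3 z1 z2 z3 q : in_lie_quotient z1 z2 z3 q ->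
  0 < v1 ^+ 2 + v2 ^+ 2 + v3 ^+ 2 ->
  cmod (fixing_eta v1 v2 v3 z1 z2 z3 q) ^+ 2 < v1 ^+ 2 + v2 ^+ 2 + v3 ^+ 2.
Proof.
move=> F v0; have q1 : cmod q < 1 by case: F.
have := fixing_etaE v1 v2 v3 z1 z2 z3 q1; rewrite /=.
set h := fixing_eta _ _ _ _ _ _ _ => wE.
have [c cE] := eta_parametrization h q1.
have [xle xeq] := Re_vector_bound c F; rewrite -cE in xle xeq.
set x1 := complex.Re (c * z1) in xle xeq; set x2 := complex.Re (c * z2) in xle xeq.
set x3 := complex.Re (c * z3) in xle xeq.
have vx : v1 * x1 + v2 * x2 + v3 * x3 = cmod h ^+ 2.
  have -> : v1 * x1 + v2 * x2 + v3 * x3 = complex.Re (c * (v1%:C * z1 + v2%:C * z2 + v3%:C * z3)).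
    rewrite /x1 /x2 /x3; case: (c) (z1) (z2) (z3) => [? ?] [? ?] [? ?] [? ?] /=; ring.
  rewrite wE cE sqr_cmod !expr2.
  by case: (c) (q) => [? ?] [? ?] /=; field.
have [c0|c0] := eqVneq c 0.
  by rewrite cE c0 rmorph0 mul0r addr0 mul0r cmod0 expr0n.
have hx : x1 ^+ 2 + x2 ^+ 2 + x3 ^+ 2 < cmod h ^+ 2.
  by rewrite lt_neqAle xle xeq (negbTE c0).
move: (cmod h ^+ 2) vx hx v0 => N vx hx v0.
have N0 : 0 < N by apply: le_lt_trans hx; rewrite !addr_ge0 ?sqr_ge0.
rewrite -(ltr_pM2r N0) -{1 2}vx.
apply: (@le_lt_trans _ _ ((v1 ^+ 2 + v2 ^+ 2 + v3 ^+ 2) * (x1 ^+ 2 + x2 ^+ 2 + x3 ^+ 2))).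
  rewrite -subr_ge0 (_ : _ - _ = (v1 * x2 - v2 * x1) ^+ 2 + (v1 * x3 - v3 * x1) ^+ 2
    + (v2 * x3 - v3 * x2) ^+ 2); last by ring.
  by rewrite !addr_ge0 ?sqr_ge0.
by rewrite ltr_pM2l.
Qed.

Section Reflection.
Variables (v1 v2 v3 : R) (h : C).
Let Q := v1 ^+ 2 + v2 ^+ 2 + v3 ^+ 2 - cmod h ^+ 2.

(** The bilinear form of R^(3,2) evaluated at (v, eta) and at the point (z, 1, q). *)
Definition refl_form (z1 z2 z3 q : C) : C :=
  v1%:C * z1 + v2%:C * z2 + v3%:C * z3 - (h + q * h^* ) / 2.

Definition refl_coef z1 z2 z3 q : C := (2 / Q)%:C * refl_form z1 z2 z3 q.

(** The reflection keeps the positive multiples of (z, 1, q) on the side of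
|q| < 1: this is the quantity to be shown positive. *)
Lemma refl_denom (z1 z2 z3 q : C) (be := refl_coef z1 z2 z3 q) c :
    0 < Q -> h = (c^* + c * q) / 2 ->
  cmod (1 - be * h^* ) ^+ 2 - cmod (q - be * h) ^+ 2
  = (1 - cmod q ^+ 2) / Q * (v1 ^+ 2 + v2 ^+ 2 + v3 ^+ 2 + cmod h ^+ 2
     - 2 * (v1 * complex.Re (c * z1) + v2 * complex.Re (c * z2) + v3 * complex.Re (c * z3))).
Proof.
move=> Q0 hE.
have bE : be = (2 / Q)%:C * refl_form z1 z2 z3 q by [].
have -> : v1 ^+ 2 + v2 ^+ 2 + v3 ^+ 2 + cmod h ^+ 2 = Q + 2 * cmod h ^+ 2 by rewrite /Q; ring.
move: Q Q0 bE => Q' Q0; rewrite /refl_form hE => ->; rewrite !sqr_cmod.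
case: (z1) (z2) (z3) (q) (c) => [? ?] [? ?] [? ?] [? ?] [? ?] /=.
by field; rewrite gt_eqF.
Qed.

(** The reflection preserves the Hermitian form |z|^2 - (|t|^2 + |k|^2)/2. *)
Lemma refl_hermitian (z1 z2 z3 q : C) (be := refl_coef z1 z2 z3 q) :
    0 < Q ->
  cmod (z1 - be * v1%:C) ^+ 2 + cmod (z2 - be * v2%:C) ^+ 2 + cmod (z3 - be * v3%:C) ^+ 2
    - (cmod (1 - be * h^* ) ^+ 2 + cmod (q - be * h) ^+ 2) / 2
  = cmod z1 ^+ 2 + cmod z2 ^+ 2 + cmod z3 ^+ 2 - (1 + cmod q ^+ 2) / 2.
Proof.
move=> Q0.
have fE : refl_form z1 z2 z3 q = be * (Q / 2)%:C.
  rewrite /be /refl_coef mulrAC -rmorphM/= (_ : _ / Q * _ = 1) ?mul1r//.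
  by field; rewrite gt_eqF.
have gen (x : C) : cmod (z1 - x * v1%:C) ^+ 2 + cmod (z2 - x * v2%:C) ^+ 2
    + cmod (z3 - x * v3%:C) ^+ 2 - (cmod (1 - x * h^* ) ^+ 2 + cmod (q - x * h) ^+ 2) / 2
  = cmod z1 ^+ 2 + cmod z2 ^+ 2 + cmod z3 ^+ 2 - (1 + cmod q ^+ 2) / 2
    + (cmod x ^+ 2 * Q - 2 * complex.Re (x^* * refl_form z1 z2 z3 q)).
  rewrite /Q /refl_form !sqr_cmod.
  by case: (z1) (z2) (z3) (q) (x) h => [? ?] [? ?] [? ?] [? ?] [? ?] [? ?] /=; field.
rewrite gen fE mulrA (mulrC _ be) mulc_conj -rmorphM/=.
by field.
Qed.

(** The reflection preserves the quadratic form z.z - k t. *)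
Lemma refl_bilinear (z1 z2 z3 q : C) (be := refl_coef z1 z2 z3 q) :
    0 < Q ->
  (q - be * h) * (1 - be * h^* ) - ((z1 - be * v1%:C) ^+ 2 + (z2 - be * v2%:C) ^+ 2
     + (z3 - be * v3%:C) ^+ 2) = q - (z1 ^+ 2 + z2 ^+ 2 + z3 ^+ 2).
Proof.
move=> Q0.
have fE : be * Q%:C = 2 * refl_form z1 z2 z3 q.
  rewrite /be /refl_coef mulrAC -rmorphM/= divfK ?gt_eqF//.
  by rewrite rmorph_nat.
have QE : Q%:C = v1%:C ^+ 2 + v2%:C ^+ 2 + v3%:C ^+ 2 - h * h^*.
  by rewrite /Q rmorphB !rmorphD !rmorphXn/= mulc_conj rmorphXn.
have -> : (q - be * h) * (1 - be * h^* ) - ((z1 - be * v1%:C) ^+ 2 + (z2 - be * v2%:C) ^+ 2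
     + (z3 - be * v3%:C) ^+ 2) = q - (z1 ^+ 2 + z2 ^+ 2 + z3 ^+ 2)
     + be * (2 * refl_form z1 z2 z3 q - be * Q%:C).
  by rewrite QE /refl_form; field.
by rewrite fE subrr mulr0 addr0.
Qed.

(** The image of (z, 1, q) under the reflection in (v, h) is
(z - be v, 1 - be conj h, q - be h).  The inequality between the two invariant
forms is preserved; that the denominator does not vanish and that the image
satisfies |k| < |t| follows from [refl_denom] and the reversed Cauchy-Schwarz
inequality [Re_vector_bound]. *)
Lemma reflection_in_lie_quotient (z1 z2 z3 q : C) (be := refl_coef z1 z2 z3 q) (t := 1 - be * h^* ) :
    0 < Q -> in_lie_quotient z1 z2 z3 q ->
  t != 0 /\ in_lie_quotient ((z1 - be * v1%:C) / t) ((z2 - be * v2%:C) / t) ((z3 - be * v3%:C) / t)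
              ((q - be * h) / t).
Proof.
move=> Q0 F; have [q1 ineq] := F.
have [c hE] := eta_parametrization h q1.
have D := refl_denom z1 z2 z3 Q0 hE.
have [xle _] := Re_vector_bound c F; rewrite -hE in xle.
have kt : cmod (q - be * h) < cmod t.
  rewrite -(ltr_pXn2r (n := 2)) ?nnegrE ?cmod_ge0// -subr_gt0 D.
  have WQ : 0 < (1 - cmod q ^+ 2) / Q.
    by apply: divr_gt0 => //; rewrite subr_gt0 expr_lt1 ?cmod_ge0.
  apply: mulr_gt0 => //.
  move: (complex.Re (c * z1)) (complex.Re (c * z2)) (complex.Re (c * z3)) xle => x1 x2 x3 xle.
  rewrite ltNge; apply/negP => le0.
  have [N NE] : exists N, N = cmod h ^+ 2 by exists (cmod h ^+ 2).
  have QN : Q = v1 ^+ 2 + v2 ^+ 2 + v3 ^+ 2 - N by rewrite NE.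
  rewrite -NE in xle le0.
  have E : (v1 - x1) ^+ 2 + (v2 - x2) ^+ 2 + (v3 - x3) ^+ 2
      + (N - (x1 ^+ 2 + x2 ^+ 2 + x3 ^+ 2)) =
    v1 ^+ 2 + v2 ^+ 2 + v3 ^+ 2 + N - 2 * (v1 * x1 + v2 * x2 + v3 * x3) by ring.
  move: le0; rewrite -E.
  have s1 := sqr_ge0 (v1 - x1); have s2 := sqr_ge0 (v2 - x2); have s3 := sqr_ge0 (v3 - x3).
  move=> K.
  have /eqP : (v1 - x1) ^+ 2 = 0 by apply/eqP; rewrite eq_le s1 andbT; clear -K s2 s3 xle; lra.
  have /eqP : (v2 - x2) ^+ 2 = 0 by apply/eqP; rewrite eq_le s2 andbT; clear -K s1 s3 xle; lra.
  have /eqP : (v3 - x3) ^+ 2 = 0 by apply/eqP; rewrite eq_le s3 andbT; clear -K s1 s2 xle; lra.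
  rewrite !sqrf_eq0 !subr_eq0 => /eqP e3 /eqP e2 /eqP e1.
  by have := Q0; rewrite QN e1 e2 e3 subr_gt0 ltNge xle.
have t0 : t != 0 by rewrite -cmod_gt0 (le_lt_trans _ kt)// cmod_ge0.
split=> //; apply: in_lie_quotient_homogeneous => //.
rewrite /t refl_bilinear//.
have := refl_hermitian z1 z2 z3 q Q0; rewrite -/be => E.
by clear -E ineq; lra.
Qed.

End Reflection.

End LieBallQuotient.

(** * The operator norm of a matrix of size 2 *)

Section Opnorm.
Variable R : realType.
Local Notation C := R[i].

Lemma sqr_l2norm2 (v : 'cV[C]_2) : l2norm v ^+ 2 = cmod (v 0 0) ^+ 2 + cmod (v 1 0) ^+ 2.
Proof.
rewrite /l2norm sqr_sqrtr; last by rewrite sumr_ge0// => i _; rewrite sqr_ge0.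
by rewrite !big_ord_recl big_ord0 addr0; congr (_ + cmod (v _ _) ^+ 2); exact: val_inj.
Qed.

Lemma l2norm_ge0 n (v : 'cV[C]_n) : 0 <= l2norm v.
Proof. exact: sqrtr_ge0. Qed.

Lemma l2normZ (k : C) (v : 'cV[C]_2) : l2norm (k *: v) = cmod k * l2norm v.
Proof.
apply/eqP; rewrite -(@eqrXn2 _ 2)// ?mulr_ge0 ?cmod_ge0 ?l2norm_ge0//.
by rewrite exprMn !sqr_l2norm2 !mxE !cmodM !exprMn mulrDr.
Qed.

(** A common bound of the quotients |A v|^2 / |v|^2 replaces the supremum. *)
Lemma opnorm_lt1_bound (A : 'M[C]_2) : (opnorm A < 1)%E <->
  exists2 k : R, k < 1 & forall v, l2norm (A *m v) ^+ 2 <= k * l2norm v ^+ 2.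
Proof.
split.
- rewrite /opnorm; set S := ereal_sup _ => S1.
  have z0 : l2norm (0 : 'cV[C]_2) = 0.
    by apply/eqP; rewrite -sqrf_eq0 sqr_l2norm2 !mxE cmod0 expr0n addr0.
  have S0 : (0 <= S)%E.
    apply: ereal_sup_ubound; exists 0; first by rewrite /= z0 ler01.
    by rewrite mulmx0 z0.
  have SE : S = (fine S)%:E by rewrite fineK// ge0_fin_numE// (lt_trans S1) ?ltry.
  have c0 : 0 <= fine S by rewrite -lee_fin -SE.
  have c1 : fine S < 1 by rewrite -lte_fin -SE.
  exists (fine S ^+ 2); first by rewrite expr_lt1.
  move=> v; rewrite -exprMn ler_pXn2r ?nnegrE ?l2norm_ge0 ?mulr_ge0 ?l2norm_ge0//.
  have [v0|v0] := eqVneq (l2norm v) 0.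
    have -> : v = 0.
      have := sqr_l2norm2 v; rewrite v0 expr0n/= => /esym/eqP.
      rewrite paddr_eq0 ?sqr_ge0// !sqrf_eq0 !cmod_eq0 => /andP[/eqP v00 /eqP v10].
      apply/colP => i; rewrite mxE.
      have [->//|->//] : i = 0 \/ i = 1.
      by case: i => -[|[|//]] ?; [left|right]; exact: val_inj.
    by rewrite mulmx0 z0 mulr0.
  have nv0 : 0 < l2norm v by rewrite lt_neqAle eq_sym v0 l2norm_ge0.
  have : ((l2norm (A *m (((l2norm v)^-1)%:C *: v)))%:E <= S)%E.
    apply: ereal_sup_ubound; exists (((l2norm v)^-1)%:C *: v) => //=.
    by rewrite l2normZ cmod_real gtr0_norm ?invr_gt0// mulVf.
  rewrite SE lee_fin -scalemxAr l2normZ cmod_real gtr0_norm ?invr_gt0//.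
  by rewrite mulrC ler_pdivrMr.
- move=> [k k1 kP].
  apply: (@le_lt_trans _ _ (Num.sqrt (Num.max k 0))%:E).
    apply: ge_ereal_sup => _ [v /= v1 <-]; rewrite lee_fin.
    rewrite -[leLHS]ger0_norm ?l2norm_ge0// -sqrtr_sqr ler_wsqrtr//.
    apply: le_trans (kP v) _.
    apply: (@le_trans _ _ (Num.max k 0 * l2norm v ^+ 2)).
      by rewrite ler_wpM2r ?sqr_ge0// le_max lexx.
    by rewrite ler_piMr ?le_max ?lexx ?orbT// expr_le1 ?l2norm_ge0.
  rewrite lte_fin -sqrtr1 ltr_sqrt ?ltr01// gt_max k1; exact: ltr01.
Qed.

Lemma det_mx22 (A : 'M[C]_2) : \det A = A 0 0 * A 1 1 - A 0 1 * A 1 0.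
Proof.
rewrite (expand_det_row _ 0) !big_ord_recl big_ord0 addr0 /cofactor !det_mx11 !mxE.
rewrite expr0 mul1r expr1 mulN1r mulrN.
by congr (A _ _ * A _ _ - A _ _ * A _ _); exact: val_inj.
Qed.

(** Both inequalities express that 1 - A^* A is positive definite.  Its
determinant is 1 + |det A|^2 minus the sum of the squares of the entries, and
|det A| < 1 excludes that both eigenvalues are negative. *)
Lemma opnorm_lt1 (A : 'M[C]_2) : (opnorm A < 1)%E <->
  cmod (\det A) < 1 /\
  cmod (A 0 0) ^+ 2 + cmod (A 0 1) ^+ 2 + cmod (A 1 0) ^+ 2 + cmod (A 1 1) ^+ 2
    < 1 + cmod (\det A) ^+ 2.
Proof.
set a := A 0 0; set b := A 0 1; set c := A 1 0; set d := A 1 1.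
have detE : \det A = a * d - b * c by exact: det_mx22.
set p := cmod a ^+ 2 + cmod c ^+ 2; set r := cmod b ^+ 2 + cmod d ^+ 2.
pose m := a^* * b + c^* * d.
have mE : cmod m ^+ 2 = p * r - cmod (\det A) ^+ 2.
  rewrite detE /p /r /m !sqr_cmod.
  by case: (a) (b) (c) (d) => [? ?] [? ?] [? ?] [? ?] /=; ring.
pose col2 (x y : C) : 'cV[C]_2 := \col_(i < 2) (if i == 0 then x else y).
have AvE v : l2norm (A *m v) ^+ 2 = p * cmod (v 0 0) ^+ 2 + r * cmod (v 1 0) ^+ 2
    + 2 * complex.Re ((v 0 0)^* * v 1 0 * m).
  rewrite sqr_l2norm2 !mxE !big_ord_recl !big_ord0 !addr0.
  have -> : lift ord0 (ord0 : 'I_1) = 1 :> 'I_2 by exact: val_inj.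
  rewrite -[ord0]/(0 : 'I_2) -/a -/b -/c -/d /p /r /m !sqr_cmod.
  by case: (a) (b) (c) (d) (v 0 0) (v 1 0) => [? ?] [? ?] [? ?] [? ?] [? ?] [? ?] /=; ring.
have p0 : 0 <= p by rewrite addr_ge0 ?sqr_ge0.
have r0 : 0 <= r by rewrite addr_ge0 ?sqr_ge0.
have -> : cmod a ^+ 2 + cmod b ^+ 2 + cmod c ^+ 2 + cmod d ^+ 2 = p + r.
  by rewrite /p /r; ring.
have col2_0 x y : (col2 x y) 0 0 = x by rewrite mxE.
have col2_1 x y : (col2 x y) 1 0 = y by rewrite mxE.
clearbody p r m col2; set D := cmod (\det A) in mE *.
have D0 : 0 <= D by exact: cmod_ge0.
split.
- move=> /opnorm_lt1_bound[k k1 kP].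
  have p1 : p < 1.
    have := kP (col2 1 0); rewrite AvE sqr_l2norm2 col2_0 col2_1 cmod1 cmod0 mulr0 mul0r/=.
    by rewrite expr1n expr0n/= !mulr1 !mulr0 !addr0 mulr1 => /le_lt_trans; apply.
  have r1 : r < 1.
    have := kP (col2 0 1); rewrite AvE sqr_l2norm2 col2_0 col2_1 cmod1 cmod0 rmorph0 !mul0r/=.
    by rewrite expr1n expr0n/= !mulr1 !mulr0 !add0r !addr0 mulr1 => /le_lt_trans; apply.
  have m0 := sqr_ge0 (cmod m).
  have pr : p * r < 1.
    apply: (@le_lt_trans _ _ p) => //; rewrite ler_piMr// ltW//.
  split.
    rewrite -(expr_lt1 (n := 2))//; move: mE m0 pr; clear; lra.
  have p1' : 0 < 1 - p by rewrite subr_gt0.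
  (* the vector that makes the form of 1 - A^* A a multiple of its determinant *)
  have := kP (col2 m (1 - p)%:C).
  rewrite AvE sqr_l2norm2 col2_0 col2_1 cmod_real gtr0_norm//.
  have -> : complex.Re (m^* * (1 - p)%:C * m) = (1 - p) * cmod m ^+ 2.
    rewrite sqr_cmod; case: (m) => ? ? /=; ring.
  move=> K.
  have N0 : 0 < cmod m ^+ 2 + (1 - p) ^+ 2 by rewrite ltr_wpDl// exprn_gt0.
  have K2 : k * (cmod m ^+ 2 + (1 - p) ^+ 2) < cmod m ^+ 2 + (1 - p) ^+ 2.
    by rewrite gtr_pMl.
  have : 0 < (1 - p) * (1 + D ^+ 2 - (p + r)).
    rewrite (_ : _ * _ = cmod m ^+ 2 + (1 - p) ^+ 2 -
      (p * cmod m ^+ 2 + r * (1 - p) ^+ 2 + 2 * ((1 - p) * cmod m ^+ 2))).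
      by rewrite subr_gt0 (le_lt_trans K).
    rewrite mE; ring.
  by rewrite pmulr_rgt0// subr_gt0.
- move=> [D1 prD].
  (* half the determinant of 1 - A^* A, a lower bound of its eigenvalues as its trace is at most 2 *)
  pose de := (1 + D ^+ 2 - (p + r)) / 2.
  have de0 : 0 < de by rewrite divr_gt0// subr_gt0.
  have DD : D ^+ 2 < 1 by rewrite expr_lt1.
  have T0 : 0 < (1 - p) + (1 - r) by move: DD prD; clear; lra.
  have h12 : (1 - p) * (1 - r) = cmod m ^+ 2 + 2 * de.
    by rewrite mE /de; field.
  have hpos : 0 < (1 - p) * (1 - r) by rewrite h12 ltr_wpDl ?sqr_ge0// mulr_gt0.
  have hp : 0 < 1 - p.
    rewrite ltNge; apply/negP => hp; have hr : 0 < 1 - r by move: hp T0; clear; lra.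
    by move: hpos; rewrite pmulr_lgt0// ltNge hp.
  have hr : 0 < 1 - r by move: hpos; rewrite pmulr_rgt0.
  have m0 := sqr_ge0 (cmod m).
  have ap : 0 <= 1 - p - de.
    have : 2 * de <= (1 - p) * 1.
      apply: (@le_trans _ _ ((1 - p) * (1 - r))); first by rewrite h12 lerDr.
      by rewrite ler_pM2l// lerBlDr lerDl.
    by move: de0; clear; lra.
  have ar : 0 <= 1 - r - de.
    have : 2 * de <= 1 * (1 - r).
      apply: (@le_trans _ _ ((1 - p) * (1 - r))); first by rewrite h12 lerDr.
      by rewrite ler_pM2r// lerBlDr lerDl.
    by move: de0; clear; lra.
  have am : cmod m ^+ 2 <= (1 - p - de) * (1 - r - de).
    rewrite (_ : _ * _ = (1 - p) * (1 - r) - de * (2 - (p + r)) + de ^+ 2); last by ring.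
    rewrite h12; have : de * (2 - (p + r)) <= de * 2.
      by rewrite ler_pM2l// lerBlDr lerDl addr_ge0.
    by have := sqr_ge0 de; clear; lra.
  apply/opnorm_lt1_bound; exists (1 - de); first by rewrite ltrBlDr ltrDl.
  move=> v; rewrite AvE sqr_l2norm2.
  set x := cmod (v 0 0); set y := cmod (v 1 0).
  have x0 : 0 <= x by exact: cmod_ge0. have y0 : 0 <= y by exact: cmod_ge0.
  have Rb : complex.Re ((v 0 0)^* * v 1 0 * m) <= x * y * cmod m.
    by apply: le_trans (ler_norm _) _; apply: le_trans (Re_le_cmod _) _; rewrite !cmodM cmod_conj.
  have key : 2 * (x * y * cmod m) <= (1 - p - de) * x ^+ 2 + (1 - r - de) * y ^+ 2.
    rewrite -(ler_pXn2r (n := 2)) ?nnegrE//; last 2 first.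
    - by rewrite !mulr_ge0 ?cmod_ge0.
    - by rewrite addr_ge0 ?mulr_ge0 ?sqr_ge0.
    move: am ap ar; move: (1 - p - de) (1 - r - de) => al be am ap ar.
    apply: (@le_trans _ _ (4 * (al * be) * (x ^+ 2 * y ^+ 2))).
      rewrite (_ : (2 * (x * y * cmod m)) ^+ 2 = 4 * cmod m ^+ 2 * (x ^+ 2 * y ^+ 2)); last by ring.
      by rewrite ler_wpM2r ?mulr_ge0 ?sqr_ge0// ler_wpM2l.
    rewrite -subr_ge0 (_ : (al * x ^+ 2 + be * y ^+ 2) ^+ 2 - 4 * (al * be) * (x ^+ 2 * y ^+ 2)
      = (al * x ^+ 2 - be * y ^+ 2) ^+ 2) ?sqr_ge0//; ring.
  by move: Rb key; clear; lra.
Qed.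

End Opnorm.

(** * The domain F is the Lie ball modulo a reflection *)

Section DomainF.
Variable R : realType.
Local Notation C := R[i].
Local Notation V n := ('rV[R[i]]_n : normedModType R[i]).

Definition iC : C := 0 +i* 1.

Lemma sqr_iC : iC ^+ 2 = -1.
Proof. by rewrite expr2; apply/eqP; rewrite eq_complex/=; apply/andP; split; apply/eqP; ring. Qed.

Definition lie_quotient : set (V 4) := [set y | in_lie_quotient (y 0 0) (y 0 i1) (y 0 i2) (y 0 i3)].

Definition row4 (a b c d : C) : 'rV[C]_4 := \row_(i < 4) [:: a; b; c; d]`_i.

Lemma row4E a b c d : [/\ row4 a b c d 0 0 = a, row4 a b c d 0 i1 = b,
  row4 a b c d 0 i2 = c & row4 a b c d 0 i3 = d].
Proof. by rewrite !mxE /= !inordK. Qed.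

Lemma row4_ext (x y : 'rV[C]_4) : x 0 0 = y 0 0 -> x 0 i1 = y 0 i1 ->
  x 0 i2 = y 0 i2 -> x 0 i3 = y 0 i3 -> x = y.
Proof. by move=> h0 h1 h2 h3; apply/rowP => i; case: (I4P i) => ->. Qed.

Lemma sum4 (F : 'I_4 -> C) : \sum_i F i = F 0 + F i1 + F i2 + F i3.
Proof.
rewrite !big_ord_recl big_ord0 addr0 !addrA.
by congr (_ + F _ + F _ + F _); apply: val_inj; rewrite /= ?inordK.
Qed.

(** From the coordinates (z_1, z_2, z_3, q) to (a_11, a_22, det A, a_12 + a_21). *)
Definition lie_to_F (y : 'rV[C]_4) : 'rV[C]_4 :=
  row4 (y 0 0 + iC * y 0 i1) (y 0 0 - iC * y 0 i1) (y 0 i3) (- 2 * iC * y 0 i2).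

Definition F_to_lie (x : 'rV[C]_4) : 'rV[C]_4 :=
  row4 ((x 0 0 + x 0 i1) / 2) (- iC * (x 0 0 - x 0 i1) / 2) (iC * x 0 i3 / 2) (x 0 i2).

Lemma lie_to_FK y : F_to_lie (lie_to_F y) = y.
Proof.
rewrite /F_to_lie /lie_to_F.
have [z0 z1 z2 z3] := row4E (y 0 0 + iC * y 0 i1) (y 0 0 - iC * y 0 i1) (y 0 i3) (- 2 * iC * y 0 i2).
rewrite z0 z1 z2 z3.
have jj := sqr_iC.
apply: row4_ext; case: (row4E ((y 0 0 + iC * y 0 i1 + (y 0 0 - iC * y 0 i1)) / 2)
  (- iC * (y 0 0 + iC * y 0 i1 - (y 0 0 - iC * y 0 i1)) / 2)
  (iC * (- 2 * iC * y 0 i2) / 2) (y 0 i3)) => e0 e1 e2 e3.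
- by rewrite e0; field.
- rewrite e1 (_ : _ / 2 = - (iC ^+ 2) * y 0 i1); last by field.
  by rewrite jj opprK mul1r.
- rewrite e2 (_ : _ / 2 = - (iC ^+ 2) * y 0 i2); last by field.
  by rewrite jj opprK mul1r.
- by rewrite e3.
Qed.

Lemma F_to_lieK x : lie_to_F (F_to_lie x) = x.
Proof.
rewrite /lie_to_F /F_to_lie.
have [z0 z1 z2 z3] := row4E ((x 0 0 + x 0 i1) / 2) (- iC * (x 0 0 - x 0 i1) / 2) (iC * x 0 i3 / 2) (x 0 i2).
rewrite z0 z1 z2 z3.
have jj := sqr_iC.
apply: row4_ext; match goal with |- fun_of_matrix (row4 ?a ?b ?c ?d) _ _ = _ =>
  case: (row4E a b c d) => e0 e1 e2 e3 end.
- rewrite e0 (_ : _ + _ = (x 0 0 + x 0 i1) / 2 - iC ^+ 2 * (x 0 0 - x 0 i1) / 2); last by field.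
  by rewrite jj; field.
- rewrite e1 (_ : _ - _ = (x 0 0 + x 0 i1) / 2 + iC ^+ 2 * (x 0 0 - x 0 i1) / 2); last by field.
  by rewrite jj; field.
- by rewrite e2.
- rewrite e3 (_ : _ * _ = - iC ^+ 2 * x 0 i3); last by field.
  by rewrite jj opprK mul1r.
Qed.

Lemma linear_row4_mx (a b c d : V 4 -> C) (f : V 4 -> V 4) : f = (fun y => row4 (a y) (b y) (c y) (d y)) ->
  (forall k x y, a (k *: x + y) = k * a x + a y) ->
  (forall k x y, b (k *: x + y) = k * b x + b y) ->
  (forall k x y, c (k *: x + y) = k * c x + c y) ->
  (forall k x y, d (k *: x + y) = k * d x + d y) ->
  exists M : 'M[C]_4, f = (fun y => y *m M).
Proof.
move=> fE la lb lc ld.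
have lf : linear f.
  move=> k x y; rewrite fE la lb lc ld; apply/rowP => i; rewrite !mxE.
  by case: i => -[|[|[|[|]]]].
pose fL : {linear 'rV[C]_4 -> 'rV[C]_4} := HB.pack f (GRing.isLinear.Build _ _ _ _ f lf).
exists (lin1_mx fL); apply/funext => y.
by rewrite mul_rV_lin1.
Qed.

Lemma lie_to_F_mx : exists M : 'M[C]_4, (lie_to_F : V 4 -> V 4) = (fun y => y *m M).
Proof. by apply: linear_row4_mx => [||||]; [reflexivity|..] => k x y; rewrite /= !mxE; ring. Qed.

Lemma F_to_lie_mx : exists M : 'M[C]_4, (F_to_lie : V 4 -> V 4) = (fun y => y *m M).
Proof. by apply: linear_row4_mx => [||||]; [reflexivity|..] => k x y; rewrite /= !mxE; field. Qed.

(** The linear isomorphism of C^4 onto the 2 x 2 matrices under which the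
determinant is the sum of the squares; transposition is w |-> - w. *)
Definition lie_matrix (z1 z2 z3 w : C) : 'M[C]_2 := \matrix_(i < 2, j < 2)
  (if i == 0 then (if j == 0 then z1 + iC * z2 else - iC * z3 + w)
   else (if j == 0 then - iC * z3 - w else z1 - iC * z2)).

Lemma lie_matrix_entries z1 z2 z3 w : [/\ lie_matrix z1 z2 z3 w 0 0 = z1 + iC * z2,
  lie_matrix z1 z2 z3 w 0 1 = - iC * z3 + w, lie_matrix z1 z2 z3 w 1 0 = - iC * z3 - w &
  lie_matrix z1 z2 z3 w 1 1 = z1 - iC * z2].
Proof. by split; rewrite mxE. Qed.

Lemma lie_matrix_surj (A : 'M[C]_2) : exists z1 z2 z3 w, A = lie_matrix z1 z2 z3 w.
Proof.
exists ((A 0 0 + A 1 1) / 2), (- iC * (A 0 0 - A 1 1) / 2),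
  (iC * (A 0 1 + A 1 0) / 2), ((A 0 1 - A 1 0) / 2).
have jj := sqr_iC.
have alg1 (a b : C) : (a + b) / 2 + iC * (- iC * (a - b) / 2) = (a + b) / 2 - iC ^+ 2 * (a - b) / 2.
  by field.
have alg2 (a b : C) : (a + b) / 2 - iC * (- iC * (a - b) / 2) = (a + b) / 2 + iC ^+ 2 * (a - b) / 2.
  by field.
have alg3 (a b : C) : - iC * (iC * (a + b) / 2) = - iC ^+ 2 * (a + b) / 2 by field.
have [e00 e01 e10 e11] := lie_matrix_entries ((A 0 0 + A 1 1) / 2) (- iC * (A 0 0 - A 1 1) / 2)
  (iC * (A 0 1 + A 1 0) / 2) ((A 0 1 - A 1 0) / 2).
have o2 (i : 'I_2) : i = 0 \/ i = 1.
  by case: i => -[|[|//]] ?; [left|right]; exact: val_inj.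
apply/matrixP => i j; case: (o2 i) => ->; case: (o2 j) => ->.
- by rewrite e00 alg1 jj; field.
- by rewrite e01 alg3 jj; field.
- by rewrite e10 alg3 jj; field.
- by rewrite e11 alg2 jj; field.
Qed.

Lemma det_lie_matrix z1 z2 z3 w : \det (lie_matrix z1 z2 z3 w) = z1 ^+ 2 + z2 ^+ 2 + z3 ^+ 2 + w ^+ 2.
Proof.
have [e00 e01 e10 e11] := lie_matrix_entries z1 z2 z3 w.
rewrite det_mx22 e00 e01 e10 e11.
rewrite (_ : _ - _ = z1 ^+ 2 - iC ^+ 2 * z2 ^+ 2 - iC ^+ 2 * z3 ^+ 2 + w ^+ 2); last by ring.
by rewrite sqr_iC; ring.
Qed.

Lemma lie_matrix_opnorm z1 z2 z3 w : (opnorm (lie_matrix z1 z2 z3 w) < 1)%E <->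
  in_lie_quotient z1 z2 z3 (z1 ^+ 2 + z2 ^+ 2 + z3 ^+ 2 + w ^+ 2).
Proof.
have [e00 e01 e10 e11] := lie_matrix_entries z1 z2 z3 w.
rewrite opnorm_lt1 det_lie_matrix e00 e01 e10 e11 /in_lie_quotient; set q := _ + w ^+ 2.
have -> : q - (z1 ^+ 2 + z2 ^+ 2 + z3 ^+ 2) = w ^+ 2 by rewrite /q addrAC subrr add0r.
rewrite cmodX ltr_pdivlMr//.
have -> : cmod (z1 + iC * z2) ^+ 2 + cmod (- iC * z3 + w) ^+ 2 + cmod (- iC * z3 - w) ^+ 2
  + cmod (z1 - iC * z2) ^+ 2 = (cmod z1 ^+ 2 + cmod z2 ^+ 2 + cmod z3 ^+ 2 + cmod w ^+ 2) * 2.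
  by rewrite !sqr_cmod; case: (z1) (z2) (z3) (w) => [? ?] [? ?] [? ?] [? ?] /=; ring.
by [].
Qed.

Lemma domainF_lie_to_F (y : 'rV[C]_4) : domainF (lie_to_F y) <-> lie_quotient y.
Proof.
have [t0 t1 t2 t3] := row4E (y 0 0 + iC * y 0 i1) (y 0 0 - iC * y 0 i1) (y 0 i3) (- 2 * iC * y 0 i2).
rewrite -[row4 _ _ _ _]/(lie_to_F y) in t0 t1 t2 t3.
have rowA z1 z2 z3 w (A := lie_matrix z1 z2 z3 w) :
  \row_(i < 4) [:: A 0 0; A 1 1; \det A; A 0 1 + A 1 0]`_i
  = lie_to_F (row4 z1 z2 z3 (z1 ^+ 2 + z2 ^+ 2 + z3 ^+ 2 + w ^+ 2)).
  have [e00 e01 e10 e11] := lie_matrix_entries z1 z2 z3 w.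
  rewrite /A e00 e01 e10 e11 det_lie_matrix /lie_to_F.
  have [-> -> -> ->] := row4E z1 z2 z3 (z1 ^+ 2 + z2 ^+ 2 + z3 ^+ 2 + w ^+ 2).
  by rewrite -[\row_i _]/(row4 _ _ _ _); congr row4; ring.
split.
- move=> [A A1]; have [z1 [z2 [z3 [w AE]]]] := lie_matrix_surj A.
  rewrite /= AE in A1 *; rewrite rowA => /(congr1 F_to_lie); rewrite !lie_to_FK => <-.
  rewrite /lie_quotient /=; have [-> -> -> ->] := row4E z1 z2 z3 (z1 ^+ 2 + z2 ^+ 2 + z3 ^+ 2 + w ^+ 2).
  by apply/lie_matrix_opnorm.
(* either of the two points of the Lie ball above y *)
- move=> Fy; pose w := sqrtc (y 0 i3 - (y 0 0 ^+ 2 + y 0 i1 ^+ 2 + y 0 i2 ^+ 2)).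
  have w2 : y 0 0 ^+ 2 + y 0 i1 ^+ 2 + y 0 i2 ^+ 2 + w ^+ 2 = y 0 i3.
    by rewrite sqr_sqrtc addrC subrK.
  exists (lie_matrix (y 0 0) (y 0 i1) (y 0 i2) w).
    by apply/lie_matrix_opnorm; rewrite w2.
  rewrite rowA w2; congr lie_to_F.
  have [r0 r1 r2 r3] := row4E (y 0 0) (y 0 i1) (y 0 i2) (y 0 i3).
  exact: row4_ext.
Qed.

End DomainF.

(** * Reflections fixing a point, acting on tangent vectors *)

Section Final.
Variable R : realType.
Local Notation C := R[i].
Local Notation V n := ('rV[R[i]]_n : normedModType R[i]).
Local Notation lie_quotient := (@lie_quotient R).
Local Notation H := (@hexablock R).

(** Two discs are compared on the unit disc only, where f o g is the identity. *)
Lemma diff_eq_on_disc n (phi psi : C^o -> V n) :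
  (forall z : C, cmod z < 1 -> phi z = psi z) ->
  differentiable phi (0 : C^o) -> differentiable psi (0 : C^o) ->
  'd phi (0 : C^o) 1 = 'd psi (0 : C^o) 1.
Proof.
move=> E dphi dpsi.
have e1 := deriveE (1 : C^o) dphi; have e2 := deriveE (1 : C^o) dpsi.
refine (etrans (esym e1) (etrans _ e2)).
apply: near_eq_derive.
apply/nbhs_ballP; exists 1 => //= z; rewrite /ball/= sub0r normrN cmod_norm => z1.
by apply: E; rewrite -ltcR.
Qed.

Section ReflectionTangent.
Variables (p : 'rV[C]_4) (v1 v2 v3 : R).
Hypothesis Fp : lie_quotient p.
Hypothesis v0 : 0 < v1 ^+ 2 + v2 ^+ 2 + v3 ^+ 2.

Let h : C := fixing_eta v1 v2 v3 (p 0 0) (p 0 i1) (p 0 i2) (p 0 i3).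
Let Q : R := v1 ^+ 2 + v2 ^+ 2 + v3 ^+ 2 - cmod h ^+ 2.
Let k : C := (2 / Q)%:C.

(** The names of this section refer to the reflection in the real vector (v, h)
that is orthogonal to the point [p]; [refl_dir] is this vector modulo [p], seen
as a tangent vector at [p], and [refl_col] is the bilinear form with it. *)
Definition refl_row : 'rV[C]_4 := row4 v1%:C v2%:C v3%:C h.
Definition refl_dir : 'rV[C]_4 := refl_row - h^* *: p.
Definition refl_col : 'cV[C]_4 := (row4 v1%:C v2%:C v3%:C (- h^* / 2))^T.
Definition refl_mx : 'M[C]_4 := 1%:M - k *: (refl_col *m refl_dir).

Let Q0 : 0 < Q.
Proof. by rewrite subr_gt0; exact: fixing_eta_lt. Qed.

Lemma refl_colE (x : 'rV[C]_4) : (x *m refl_col) 0 0 =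
  v1%:C * x 0 0 + v2%:C * x 0 i1 + v3%:C * x 0 i2 - x 0 i3 * h^* / 2.
Proof.
rewrite mxE sum4; have [e0 e1 e2 e3] := row4E v1%:C v2%:C v3%:C (- h^* / 2).
by rewrite ![refl_col _ _]mxE e0 e1 e2 e3; field.
Qed.

Lemma refl_formE (x : 'rV[C]_4) : refl_form v1 v2 v3 h (x 0 0) (x 0 i1) (x 0 i2) (x 0 i3)
  = (x *m refl_col) 0 0 - h / 2.
Proof. by rewrite refl_colE /refl_form; field. Qed.

Lemma refl_form_p : (p *m refl_col) 0 0 = h / 2.
Proof.
have q1 : cmod (p 0 i3) < 1 by case: Fp.
have := fixing_etaE v1 v2 v3 (p 0 0) (p 0 i1) (p 0 i2) q1; rewrite /= -/h => E.
by rewrite refl_colE E; field.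
Qed.

Lemma refl_dir_col : (refl_dir *m refl_col) 0 0 = Q%:C.
Proof.
rewrite mulmxBl -scalemxAl [LHS]mxE [X in _ + X]mxE [X in _ - X]mxE refl_form_p refl_colE.
have [e0 e1 e2 e3] := row4E v1%:C v2%:C v3%:C h.
have -> : Q%:C = v1%:C ^+ 2 + v2%:C ^+ 2 + v3%:C ^+ 2 - h * h^*.
  by rewrite /Q rmorphB !rmorphD !rmorphXn/= mulc_conj rmorphXn.
by rewrite /refl_row e0 e1 e2 e3; field.
Qed.

Lemma refl_norm_neq0 : Q%:C != 0.
Proof. by rewrite -(rmorph0 (real_complex R)) (inj_eq (@complexI R)) gt_eqF. Qed.

Lemma refl_coef_neq0 : k != 0.
Proof. by rewrite -(rmorph0 (real_complex R)) (inj_eq (@complexI R)) gt_eqF// divr_gt0. Qed.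

Lemma refl_coefM : k * Q%:C = 2.
Proof. by rewrite -rmorphM/= divfK ?gt_eqF// rmorph_nat. Qed.

Lemma refl_mxE (x : 'rV[C]_4) : x *m refl_mx = x - (k * (x *m refl_col) 0 0) *: refl_dir.
Proof.
rewrite mulmxBr mulmx1 -scalemxAr mulmxA -scalerA; congr (_ - _ *: _).
by rewrite {1}[x *m refl_col]mx11_scalar mul_scalar_mx.
Qed.

Lemma refl_mx_involutive : refl_mx *m refl_mx = 1%:M.
Proof.
apply/row_matrixP => i; rewrite !rowE mulmx1 mulmxA.
set e := delta_mx _ _.
have colB (x : 'rV[C]_4) c : ((x - c *: refl_dir) *m refl_col) 0 0
    = (x *m refl_col) 0 0 - c * Q%:C.
  by rewrite mulmxBl -scalemxAl -refl_dir_col mxE [X in _ + X]mxE [X in _ - X]mxE.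
rewrite (refl_mxE (e *m refl_mx)) refl_mxE colB.
set b := (_ *m refl_col) 0 0.
rewrite -addrA -opprD -scalerDl -[RHS]subr0; congr (_ - _).
rewrite (_ : _ + _ = (2 - k * Q%:C) * (k * b)); last by ring.
by rewrite refl_coefM subrr mul0r scale0r.
Qed.

Definition refl_tau (y : V 4) : C^o := (y *m (- (k * h^* ) *: refl_col)) 0 0 + (1 + k * h^* * (h / 2)).
Definition refl_num (i : 'I_4) (y : V 4) : C^o :=
  (y *m (delta_mx i 0 - (k * refl_row 0 i) *: refl_col)) 0 0 + k * refl_row 0 i * (h / 2).
Definition refl_map (y : V 4) : V 4 := \row_i (refl_num i y / refl_tau y).

Let be (y : 'rV[C]_4) := refl_coef v1 v2 v3 h (y 0 0) (y 0 i1) (y 0 i2) (y 0 i3).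

Lemma beE y : be y = k * ((y *m refl_col) 0 0 - h / 2).
Proof. by rewrite /be /refl_coef refl_formE. Qed.

Lemma refl_tauE y : refl_tau y = 1 - be y * h^*.
Proof. by rewrite /refl_tau -scalemxAr mxE beE; ring. Qed.

Lemma refl_numE i y : refl_num i y = y 0 i - be y * refl_row 0 i.
Proof.
rewrite /refl_num mulmxBr mxE [X in X + _ + _](_ : _ = y 0 i).
  by rewrite -scalemxAr [X in _ + X + _]mxE [X in _ - X + _]mxE beE; ring.
by rewrite -colE mxE.
Qed.

Lemma be_p : be p = 0.
Proof. by rewrite beE refl_form_p subrr mulr0. Qed.

Lemma refl_map_lie_quotient y : lie_quotient y -> refl_tau y != 0 /\ lie_quotient (refl_map y).
Proof.
move=> Fy.
have := @reflection_in_lie_quotient R v1 v2 v3 h _ _ _ _ Q0 Fy.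
rewrite -/(be y) -refl_tauE => -[t0 F]; split=> //.
rewrite /refl_map /lie_quotient /= ![(\row_i _) _ _]mxE !refl_numE.
by have [-> -> -> ->] := row4E v1%:C v2%:C v3%:C h.
Qed.

Lemma refl_map_p : refl_map p = p.
Proof.
apply/rowP => i; rewrite mxE refl_numE refl_tauE be_p !mul0r !subr0.
by rewrite divr1.
Qed.

Lemma refl_map_diff y : refl_tau y != 0 -> differentiable refl_map y.
Proof.
move=> t0; apply: (differentiable_row _).1 => i.
exact: (diff_quotient (diff_affine _ _ _).1 (diff_affine _ _ _).1 t0).1.
Qed.

(** The denominator [refl_tau] is 1 at [p] and the coefficient of the reflection
vanishes there, so that only its linear part contributes, once directly and
once through the denominator. *)
Lemma refl_map_diff_p (v : V 4) : 'd refl_map (p : V 4) v = v *m refl_mx.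
Proof.
have tp : refl_tau p = 1 by rewrite refl_tauE be_p mul0r subr0.
have tp0 : refl_tau p != 0 by rewrite tp oner_eq0.
have dq i := diff_quotient (diff_affine (delta_mx i 0 - (k * refl_row 0 i) *: refl_col)
   (k * refl_row 0 i * (h / 2)) p).1 (diff_affine (- (k * h^* ) *: refl_col) (1 + k * h^* * (h / 2)) p).1 tp0.
have [_ E] := differentiable_row (fun i => (dq i).1).
apply: (etrans (E v)); apply/rowP => i; rewrite [LHS]mxE.
have [_ Eq] := dq i; apply: (etrans (Eq tp v)).
have E1 := (diff_affine (delta_mx i 0 - (k * refl_row 0 i) *: refl_col)
   (k * refl_row 0 i * (h / 2)) p).2 v.
have E2 := (diff_affine (- (k * h^* ) *: refl_col) (1 + k * h^* * (h / 2)) p).2 v.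
apply: (etrans (congr2 (fun a b : C => a - refl_num i p * b) E1 E2)).
rewrite refl_numE be_p mul0r subr0 refl_mxE mulmxBr -!scalemxAr -colE.
by rewrite /refl_dir !mxE; ring.
Qed.

Lemma refl_tangent v : disc_tangent lie_quotient p v -> disc_tangent lie_quotient p (v *m refl_mx).
Proof.
move=> Iv.
have := @disc_tangent_push R 4 4 lie_quotient lie_quotient refl_map p v.
rewrite refl_map_diff_p refl_map_p; apply.
- by move=> y /refl_map_lie_quotient[t0 _]; exact: refl_map_diff.
- by move=> y /refl_map_lie_quotient[].
- exact: Iv.
Qed.

End ReflectionTangent.

End Final.

(** * Comparison of the two domains *)

Section Final.
Variable R : realType.
Local Notation C := R[i].
Local Notation V n := ('rV[R[i]]_n : normedModType R[i]).
Local Notation lie_quotient := (@lie_quotient R).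
Local Notation H := (@hexablock R).

(** The real vectors orthogonal to a point form a real space parametrized
linearly by their component in R^3. *)
Lemma fixing_eta_linear (v1 v2 v3 : R) (z1 z2 z3 q : C) :
  fixing_eta v1 v2 v3 z1 z2 z3 q = v1%:C * fixing_eta 1 0 0 z1 z2 z3 q
    + v2%:C * fixing_eta 0 1 0 z1 z2 z3 q + v3%:C * fixing_eta 0 0 1 z1 z2 z3 q.
Proof.
rewrite /fixing_eta; move: (1 - _ ^+ 2) => D.
case: z1 z2 z3 q => [? ?] [? ?] [? ?] [? ?]; apply/eqP; rewrite eq_complex /=.
by apply/andP; split; apply/eqP; ring.
Qed.

Definition j0 : 'I_3 := inord 0.
Definition j1 : 'I_3 := inord 1.
Definition j2 : 'I_3 := inord 2.

Lemma sum3 (F : 'I_3 -> C) : \sum_i F i = F j0 + F j1 + F j2.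
Proof.
rewrite !big_ord_recl big_ord0 addr0 !addrA.
by congr (F _ + F _ + F _); apply: val_inj; rewrite /= ?inordK.
Qed.

Lemma I3P (j : 'I_3) : [\/ j = j0, j = j1 | j = j2].
Proof.
case: j => -[|[|[|//]]] jP; [apply: Or31|apply: Or32|apply: Or33];
  by apply: val_inj; rewrite /= inordK.
Qed.

Lemma j3_eq : [/\ (j0 == j1) = false, (j0 == j2) = false, (j1 == j0) = false &
  [/\ (j1 == j2) = false, (j2 == j0) = false & (j2 == j1) = false]].
Proof. by rewrite -!val_eqE/= !inordK. Qed.

(** The directions of the reflections for the three unit vectors of R^3. *)
Definition refl_dirs (p : 'rV[C]_4) : 'M[C]_(3, 4) :=
  \matrix_(i < 3, j < 4) refl_dir p (i == j0)%:R (i == j1)%:R (i == j2)%:R 0 j.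

Lemma refl_dirE (p : 'rV[C]_4) (v1 v2 v3 : R)
   (h := fixing_eta v1 v2 v3 (p 0 0) (p 0 i1) (p 0 i2) (p 0 i3)) :
  [/\ refl_dir p v1 v2 v3 0 0 = v1%:C - h^* * p 0 0,
      refl_dir p v1 v2 v3 0 i1 = v2%:C - h^* * p 0 i1,
      refl_dir p v1 v2 v3 0 i2 = v3%:C - h^* * p 0 i2 &
      refl_dir p v1 v2 v3 0 i3 = h - h^* * p 0 i3].
Proof.
have [e0 e1 e2 e3] := row4E v1%:C v2%:C v3%:C h.
by split; rewrite mxE [X in _ + X]mxE [X in _ - X]mxE /refl_row ?e0 ?e1 ?e2 ?e3.
Qed.

Section AtPoint.
Variable p : 'rV[C]_4.
Let h0 : C := fixing_eta 1 0 0 (p 0 0) (p 0 i1) (p 0 i2) (p 0 i3).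
Let h1 : C := fixing_eta 0 1 0 (p 0 0) (p 0 i1) (p 0 i2) (p 0 i3).
Let h2 : C := fixing_eta 0 0 1 (p 0 0) (p 0 i1) (p 0 i2) (p 0 i3).

Lemma refl_dirs_mulE (t : 'rV[C]_3)
    (s := t 0 j0 * h0^* + t 0 j1 * h1^* + t 0 j2 * h2^* ) :
  [/\ (t *m refl_dirs p) 0 0 = t 0 j0 - s * p 0 0,
      (t *m refl_dirs p) 0 i1 = t 0 j1 - s * p 0 i1,
      (t *m refl_dirs p) 0 i2 = t 0 j2 - s * p 0 i2 &
      (t *m refl_dirs p) 0 i3 = t 0 j0 * h0 + t 0 j1 * h1 + t 0 j2 * h2 - s * p 0 i3].
Proof.
have [d01 d02 d10 [d12 d20 d21]] := j3_eq.
have [a0 a1 a2 a3] := refl_dirE p 1 0 0.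
have [b0 b1 b2 b3] := refl_dirE p 0 1 0.
have [c0 c1 c2 c3] := refl_dirE p 0 0 1.
rewrite -/h0 in a0 a1 a2 a3; rewrite -/h1 in b0 b1 b2 b3; rewrite -/h2 in c0 c1 c2 c3.
have W0 j : refl_dirs p j0 j = refl_dir p 1 0 0 0 j by rewrite mxE eqxx d01 d02.
have W1 j : refl_dirs p j1 j = refl_dir p 0 1 0 0 j by rewrite mxE eqxx d10 d12.
have W2 j : refl_dirs p j2 j = refl_dir p 0 0 1 0 j by rewrite mxE eqxx d20 d21.
split; rewrite mxE sum3 /s.
- rewrite (etrans (W0 0) a0) (etrans (W1 0) b0) (etrans (W2 0) c0).
  by rewrite rmorph0 rmorph1; ring.
- rewrite (etrans (W0 i1) a1) (etrans (W1 i1) b1) (etrans (W2 i1) c1).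
  by rewrite rmorph0 rmorph1; ring.
- rewrite (etrans (W0 i2) a2) (etrans (W1 i2) b2) (etrans (W2 i2) c2).
  by rewrite rmorph0 rmorph1; ring.
- rewrite (etrans (W0 i3) a3) (etrans (W1 i3) b3) (etrans (W2 i3) c3).
  by ring.
Qed.

Lemma refl_dirs_real (t : 'rV[R]_3) :
  map_mx (real_complex R) t *m refl_dirs p = refl_dir p (t 0 j0) (t 0 j1) (t 0 j2).
Proof.
have [m0 m1 m2 m3] := refl_dirs_mulE (map_mx (real_complex R) t).
have [a0 a1 a2 a3] := refl_dirE p (t 0 j0) (t 0 j1) (t 0 j2).
rewrite fixing_eta_linear -/h0 -/h1 -/h2 in a0 a1 a2 a3.
have cE : (t 0 j0)%:C * h0^* + (t 0 j1)%:C * h1^* + (t 0 j2)%:C * h2^*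
   = ((t 0 j0)%:C * h0 + (t 0 j1)%:C * h1 + (t 0 j2)%:C * h2)^*.
  case: (h0) (h1) (h2) => [? ?] [? ?] [? ?]; apply/eqP; rewrite eq_complex /=.
  by apply/andP; split; apply/eqP; ring.
apply: row4_ext.
- by rewrite m0 a0 !mxE cE.
- by rewrite m1 a1 !mxE cE.
- by rewrite m2 a2 !mxE cE.
- by rewrite m3 a3 !mxE cE.
Qed.

(** A complex relation between the directions of the reflections would give a
vector orthogonal to the point z and proportional to it, which forces first
q = z.z and then |z|^2 = (1 + |q|^2)/2, against the inequality of the domain. *)
Lemma refl_dirs_inj (t : 'rV[C]_3) : lie_quotient p -> t *m refl_dirs p = 0 -> t = 0.
Proof.
move=> [q1 Fp] tW.
have [m0 m1 m2 m3] := refl_dirs_mulE t.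
move: m0 m1 m2 m3; rewrite tW ![(0 : 'rV[C]_4) _ _]mxE.
set s := _ + _ + t 0 j2 * h2^*.
move=> /eqP; rewrite eq_sym subr_eq0 => /eqP e0.
move=> /eqP; rewrite eq_sym subr_eq0 => /eqP e1.
move=> /eqP; rewrite eq_sym subr_eq0 => /eqP e2.
move=> /eqP; rewrite eq_sym subr_eq0 => /eqP e3.
have [s0|s0] := eqVneq s 0.
  rewrite s0 !mul0r in e0 e1 e2.
  apply/rowP => j; rewrite mxE.
  by case: (I3P j) => ->.
exfalso.
set q := p 0 i3 in q1 Fp e3.
set z1 := p 0 0 in e0 Fp; set z2 := p 0 i1 in e1 Fp; set z3 := p 0 i2 in e2 Fp.
have W0 : 0 < 1 - cmod q ^+ 2 by rewrite subr_gt0 expr_lt1 ?cmod_ge0.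
have DE : (1 - cmod q ^+ 2)%:C = 1 - q * q^* by rewrite mulc_conj rmorphB rmorph1.
have D0 : 1 - q * q^* != 0.
  by rewrite -DE -(rmorph0 (real_complex R)) (inj_eq (@complexI R)) gt_eqF.
pose n := z1 * z1^* + z2 * z2^* + z3 * z3^*.
pose zz := z1 ^+ 2 + z2 ^+ 2 + z3 ^+ 2.
have hE : [/\ h0 = 2 * (z1 - q * z1^* ) / (1 - q * q^* ),
   h1 = 2 * (z2 - q * z2^* ) / (1 - q * q^* ) & h2 = 2 * (z3 - q * z3^* ) / (1 - q * q^* )].
  rewrite /h0 /h1 /h2 /fixing_eta -/z1 -/z2 -/z3 -/q DE !rmorph0 !rmorph1.
  by rewrite !mul0r !mul1r !addr0 !add0r.
have hcE : [/\ h0^* = 2 * (z1^* - q^* * z1) / (1 - q * q^* ),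
   h1^* = 2 * (z2^* - q^* * z2) / (1 - q * q^* ) & h2^* = 2 * (z3^* - q^* * z3) / (1 - q * q^* )].
  by have [-> -> ->] := hE; rewrite -DE !conj_frac !conjM !conjCK.
have E1 : 2 * (zz - q * n) = q * (1 - q * q^* ).
  apply: (mulfI s0); move: e3; have [-> -> ->] := hE; rewrite e0 e1 e2 => e3.
  rewrite [RHS]mulrA -e3 /n /zz; field.
  exact: D0.
have E2 : 2 * (n - q^* * zz) = 1 - q * q^*.
  apply: (mulfI s0); rewrite -{2}[s]/(t 0 j0 * h0^* + t 0 j1 * h1^* + t 0 j2 * h2^* ).
  have [-> -> ->] := hcE; rewrite e0 e1 e2 /n /zz; field.
  exact: D0.
have zzE : zz = q.
  apply: (mulfI D0); apply: (mulfI (_ : (2 : C) != 0)); first by rewrite pnatr_eq0.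
  have : 2 * (zz - q * n) + q * (2 * (n - q^* * zz)) = 2 * q * (1 - q * q^* ).
    by rewrite E1 E2; ring.
  move=> E.
  have -> : 2 * ((1 - q * q^* ) * zz) = 2 * (zz - q * n) + q * (2 * (n - q^* * zz)) by ring.
  by rewrite E; ring.
have nE : n = (cmod z1 ^+ 2 + cmod z2 ^+ 2 + cmod z3 ^+ 2)%:C.
  by rewrite /n !mulc_conj -!rmorphD.
have : cmod z1 ^+ 2 + cmod z2 ^+ 2 + cmod z3 ^+ 2 = (1 + cmod q ^+ 2) / 2.
  have K : 2 * n = 1 + q * q^*.
    by rewrite -(subrK (2 * (q^* * zz)) (2 * n)) -mulrBr E2 zzE; ring.
  move: K; rewrite nE mulc_conj -(rmorph_nat (real_complex R) 2) -(rmorph1 (real_complex R)).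
  by rewrite -rmorphM -rmorphD => /complexI K; rewrite -K mulrC mulKf// pnatr_eq0.
by move: Fp; rewrite -/zz zzE subrr cmod0 addr0 => /[swap] ->; rewrite ltxx.
Qed.

End AtPoint.

(** The matrices [A] and [B] of the differentials of f at p = g(0) and of g at 0
are inverse to each other, because B followed by A fixes the tangent vectors of
the hexablock at 0, which span C^4.  Every reflection S fixing p gives the
involution B S A, to which [involutive_symmetry_monomial] applies. *)
Lemma no_biholomorphism (f g : V 4 -> V 4) :
  holomorphic_on lie_quotient f -> holomorphic_on H g ->
  (forall y, lie_quotient y -> H (f y)) -> (forall y, H y -> lie_quotient (g y)) ->
  (forall y, H y -> f (g y) = y) -> False.
Proof.
move=> hf hg fH gF fg.
have tb := hexa_test_body R.
have H0 : H 0.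
  have [phi [phiH phi0 _]] := tb_diag tb 0.
  by rewrite -phi0; apply: (phiH 0 _).1; rewrite cmod0.
pose p : V 4 := g 0.
have Fp : lie_quotient p by exact: gF.
have fp : f p = 0 by exact: fg.
pose A : 'M[C]_4 := lin1_mx ('d f p).
pose B : 'M[C]_4 := lin1_mx ('d g (0 : V 4)).
have AE (v : V 4) : 'd f p v = v *m A by exact: (esym (mul_rV_lin1 ('d f p) v)).
have BE (v : V 4) : 'd g (0 : V 4) v = v *m B.
  exact: (esym (mul_rV_lin1 ('d g (0 : V 4)) v)).
clearbody A B.
have pushA v : disc_tangent lie_quotient p v -> disc_tangent H 0 (v *m A).
  by move=> /(disc_tangent_push hf fH); rewrite fp AE.
have pushB v : disc_tangent H 0 v -> disc_tangent lie_quotient p (v *m B).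
  by move=> /(disc_tangent_push hg gF); rewrite BE.
have BAw w : disc_tangent H 0 w -> w *m B *m A = w.
  case=> phi [phiH phi0 phi1].
  have c0 : cmod (0 : C) < 1 by rewrite cmod0.
  have [_ dphi] := phiH 0 c0.
  have dg : differentiable g (phi 0) by rewrite phi0; exact: hg.
  have df : differentiable f (g (phi 0)) by rewrite phi0; exact: hf.
  have dgp : differentiable (g \o phi) (0 : C^o) by exact: differentiable_comp dphi dg.
  have dfgp : differentiable (f \o (g \o phi)) (0 : C^o) by exact: differentiable_comp dgp df.
  have E := @diff_eq_on_disc R 4 (f \o (g \o phi)) phi (fun z z1 => fg _ (phiH z z1).1) dfgp dphi.
  rewrite -[RHS]phi1 -E.
  have E1 := congr1 (fun h : C^o -> V 4 => h 1) (diff_comp dgp df).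
  have E2 := congr1 (fun h : C^o -> V 4 => h 1) (diff_comp dphi dg).
  apply/esym; apply: (etrans E1); rewrite /= in E2 *.
  rewrite E2 phi0 phi1 -/p.
  by apply: (etrans (AE _)); exact: (congr1 (fun x : 'rV[C]_4 => x *m A) (BE w)).
have BA : B *m A = 1%:M.
  have ej (j : 'I_4) : (delta_mx 0 j : 'rV[C]_4) *m (B *m A) = delta_mx 0 j.
    (* e_j + e_j' and e_j - e_j' are both tangent vectors *)
    pose d : 'rV[C]_4 := \row_i (if i == j then 1 else -1).
    have d1 i : cmod (d 0 i) = 1 by rewrite mxE; case: ifP => _; rewrite ?cmodN cmod1.
    have I1 := tb_diag tb j; have I2 := tb_torus tb d1 I1.
    have dE : \row_(i < 4) (d 0 i * (delta_mx 0 j + delta_mx 0 (rev_ord j) : 'rV[C]_4) 0 i) =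
        delta_mx 0 j - delta_mx 0 (rev_ord j) :> 'rV[C]_4.
      apply/rowP => i; rewrite !mxE eqxx /=.
      case: (eqVneq i j) => [->|ij] /=.
        by rewrite [j == _]eq_sym (negbTE (rev4 j)) /= subr0 addr0 mulr1.
      by rewrite add0r sub0r mulN1r.
    rewrite dE in I2.
    have S1 := BAw _ I1; have S2 := BAw _ I2.
    have : (2 : C) *: ((delta_mx 0 j : 'rV[C]_4) *m (B *m A)) = 2 *: delta_mx 0 j.
      rewrite scalemxAl !mulmxA.
      have -> : (2 : C) *: delta_mx 0 j = (delta_mx 0 j + delta_mx 0 (rev_ord j))
        + (delta_mx 0 j - delta_mx 0 (rev_ord j)) :> 'rV[C]_4.
        by rewrite addrACA subrr addr0 scaler_nat mulr2n.
      by rewrite mulmxDl mulmxDl S1 S2.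
    by move/(scalerI (_ : (2 : C) != 0)); apply; rewrite pnatr_eq0.
  by apply/row_matrixP => i; rewrite !rowE ej mulmx1.
have AB : A *m B = 1%:M by exact: mulmx1C.
apply: (@real_combinations_not_sparse R (refl_dirs p *m A)).
  move=> t tN; apply: (refl_dirs_inj Fp).
  by rewrite -[t *m _]mulmx1 -AB !mulmxA -[t *m _ *m A]mulmxA tN mul0mx.
move=> t t0; rewrite mulmxA refl_dirs_real.
set v1 := t 0 j0; set v2 := t 0 j1; set v3 := t 0 j2.
have v0 : 0 < v1 ^+ 2 + v2 ^+ 2 + v3 ^+ 2.
  rewrite lt_neqAle !addr_ge0 ?sqr_ge0// andbT eq_sym; apply: contra t0.
  rewrite !paddr_eq0 ?addr_ge0 ?sqr_ge0// !sqrf_eq0 => /andP[/andP[/eqP e1 /eqP e2] /eqP e3].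
  apply/eqP/rowP => j; rewrite mxE.
  by case: (I3P j) => ->.
pose S := refl_mx p v1 v2 v3.
pose G := B *m S *m A.
have SS : S *m S = 1%:M by exact: refl_mx_involutive.
have GG : G *m G = 1%:M.
  rewrite /G; clearbody S; rewrite (_ : _ *m _ = B *m S *m (A *m B) *m S *m A).
    by rewrite AB mulmx1 -(mulmxA B S S) SS mulmx1.
  by rewrite !mulmxA.
have GI v : disc_tangent H 0 v -> disc_tangent H 0 (v *m G).
  by move=> /pushB/(refl_tangent Fp v0)/pushA; rewrite /G !mulmxA.
have mono := involutive_symmetry_monomial tb GG GI.
(* B S A differs from the identity by the rank one matrix bb ww *)
pose bb := B *m refl_col p v1 v2 v3.
pose ww := refl_dir p v1 v2 v3 *m A.
have wb : (ww *m bb) 0 0 != 0.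
  rewrite /ww /bb mulmxA -[_ *m A *m B]mulmxA AB mulmx1 refl_dir_col//.
  exact: refl_norm_neq0.
have [i bi] : exists i, bb i 0 != 0.
  apply/existsP; apply: contraR wb; rewrite negb_exists => /forallP bb0.
  apply/eqP; rewrite mxE big1// => i _.
  by have := bb0 i; rewrite negbK => /eqP ->; rewrite mulr0.
have [k kP] := mono i.
exists k, i => j jk ji.
have := kP j jk.
rewrite /G /S /refl_mx mulmxBr mulmx1 mulmxBl BA.
rewrite -scalemxAr -scalemxAl mulmxA -[_ *m _ *m A]mulmxA -/bb -/ww.
have entry (b : 'cV[C]_4) (w : 'rV[C]_4) c :
    (1%:M - c *: (b *m w)) i j = (i == j)%:R - c * (b i 0 * w 0 j).
  by rewrite !mxE big_ord1.
rewrite entry eq_sym (negbTE ji) sub0r => /eqP.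
rewrite oppr_eq0 mulf_eq0 (negbTE (refl_coef_neq0 Fp v0)) /= mulf_eq0 (negbTE bi) /=.
by move=> /eqP.
Qed.

End Final.

Theorem theorem3p6 (R : realType) :
  ~ biholomorphic (@domainF R) (@hexablock R).
Proof.
move=> [f [fbij hf [g hg gf]]].
have [T TE] := lie_to_F_mx R; have [T' TE'] := F_to_lie_mx R.
pose V4 : normedModType R[i] := 'rV[R[i]]_4.
have dT (y : V4) : differentiable (@lie_to_F R : V4 -> V4) y.
  by rewrite TE; exact: (diff_mulmx _ _).1.
have dT' (y : V4) : differentiable (@F_to_lie R : V4 -> V4) y.
  by rewrite TE'; exact: (diff_mulmx _ _).1.
have [fF fsurj] : (forall x, domainF x -> hexablock (f x)) /\
   (forall y, hexablock y -> exists2 x, domainF x & f x = y).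
  have [ff _ fs] := fbij; split=> [x Fx|y Hy]; first exact: ff.
  by have [x Fx xy] := fs y Hy; exists x.
apply: (@no_biholomorphism R (f \o @lie_to_F R) (@F_to_lie R \o g)).
- move=> y Fy; apply: differentiable_comp; first exact: dT.
  by apply: hf; apply/domainF_lie_to_F.
- move=> y Hy; apply: differentiable_comp; last exact: dT'.
  exact: hg.
- by move=> y Fy; apply: fF; apply/domainF_lie_to_F.
- move=> y Hy; apply/domainF_lie_to_F; rewrite /= F_to_lieK.
  by have [x Fx <-] := fsurj y Hy; rewrite gf.
- move=> y Hy; rewrite /= F_to_lieK.
  by have [x Fx <-] := fsurj y Hy; rewrite gf.
Qed.
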